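(* There is an algorithm that, given a set $P$ of $k$ points in $\mathbb{R}^d$ (with $d$ and $k$ part of the input), computes in time polynomial in $d$ and $k$ a hyperplane of $\mathbb{R}^d$ that contains $\Omega\!\left(\frac{\mathrm{OPT}\,\log k}{k\log\log k}\right)$ points of $P$, where $\mathrm{OPT}$ denotes the maximum number of points of $P$ that a single hyperplane of $\mathbb{R}^d$ can contain. *)

(* Defs.v *)
From HB Require Import structures.
From mathcomp Require Import all_boot all_order all_algebra.
From mathcomp Require Import boolp reals exp.
Set Implicit Arguments. Unset Strict Implicit. Unset Printing Implicit Defensive.
Import Order.TTheory GRing.Theory Num.Theory.
Local Open Scope ring_scope.

Definition on_hp (R : realType) (d k : nat) (a : 'rV[R]_d) (b : R)
    (P : 'I_k -> 'rV[R]_d) : {set 'I_k} :=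
  [set i | (P i *m a^T) 0 0 == b].

Definition OPT (R : realType) (d k : nat) (P : 'I_k -> 'rV[R]_d) : nat :=
  \max_(S : {set 'I_k} | `[< exists a b, a != 0 /\ S = on_hp a b P >]) #|S|.

(* Real-RAM: natural-number registers N (for indices/loop counters,    *)
(* only + and truncated -), real registers X (field operations,        *)
(* comparisons), indirect addressing of X through N.  Unit cost.       *)

Inductive instr : Type :=
| NSet   (i c : nat)
| NAdd   (i j l : nat)
| NSub   (i j l : nat)      (* N[i] := N[j] - N[l] (truncated) *)
| XZero  (i : nat)
| XOne   (i : nat)
| XAdd   (i j l : nat)
| XSub   (i j l : nat)
| XMul   (i j l : nat)
| XDiv   (i j l : nat)      (* X[i] := X[j] / X[l]  (x/0 = 0) *)
| XLoad  (i j : nat)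
| XStore (i j : nat)
| JNLt   (i j t : nat)
| JXLt   (i j t : nat)
| JXEq   (i j t : nat)
| Jmp    (t : nat)
| Halt.

Record state (R : realType) := State {
  pc : nat; nreg : nat -> nat; xreg : nat -> R }.

Definition upd {T : Type} (f : nat -> T) (i : nat) (v : T) : nat -> T :=
  fun j => if j == i then v else f j.

(* One step; [None] means the machine has halted (Halt or pc out of range). *)
Definition step (R : realType) (p : seq instr) (s : state R) : option (state R) :=
  let: State q N X := s in
  let nx := q.+1 in
  match nth Halt p q with
  | NSet i c => Some (State nx (upd N i c) X)
  | NAdd i j l => Some (State nx (upd N i (N j + N l)%N) X)
  | NSub i j l => Some (State nx (upd N i (N j - N l)%N) X)
  | XZero i => Some (State nx N (upd X i 0))
  | XOne i => Some (State nx N (upd X i 1))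
  | XAdd i j l => Some (State nx N (upd X i (X j + X l)))
  | XSub i j l => Some (State nx N (upd X i (X j - X l)))
  | XMul i j l => Some (State nx N (upd X i (X j * X l)))
  | XDiv i j l => Some (State nx N (upd X i (X j / X l)))
  | XLoad i j => Some (State nx N (upd X i (X (N j))))
  | XStore i j => Some (State nx N (upd X (N i) (X j)))
  | JNLt i j t => Some (State (if (N i < N j)%N then t else nx) N X)
  | JXLt i j t => Some (State (if X i < X j then t else nx) N X)
  | JXEq i j t => Some (State (if X i == X j then t else nx) N X)
  | Jmp t => Some (State t N X)
  | Halt => None
  end.

Fixpoint run (R : realType) (p : seq instr) (n : nat) (s : state R)
  : option (state R) :=
  match step p s with
  | None => Some s
  | Some s' => match n with 0 => None | n'.+1 => run p n' s' end
  end.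

(* Input convention: N[0] = d, N[1] = k, coordinate t of point i is stored in
   X[i*d + t]; all other registers are 0; pc = 0. *)
Definition init_state (R : realType) (d k : nat) (P : 'I_k -> 'rV[R]_d)
  : state R :=
  State 0
    (fun j => if j == 0%N then d else if j == 1%N then k else 0%N)
    (fun j => \sum_(i < k) \sum_(t < d)
                 (if j == (i * d + t)%N then P i 0 t else 0)).

(* Output convention: the hyperplane {x | x . a = b} with
   a = (X[0], ..., X[d-1]) and b = X[d]. *)
Definition out_a (R : realType) (d : nat) (s : state R) : 'rV[R]_d :=
  \row_(t < d) xreg s t.
Definition out_b (R : realType) (d : nat) (s : state R) : R := xreg s d.

(* Main.v *)
(* Cut the points into blocks of t consecutive points, where t is about log2 k.
   If a hyperplane contains OPT points, it contains at least OPT * t / (2 k) of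
   the points of some block. A block has only 2^t = O(k) subsets, so all of
   them can be tried, and for each one a hyperplane through it is found (or
   refuted) by linear algebra in homogeneous coordinates (p, -1): the orthogonal
   projector M onto the complement of the chosen points is updated one point at
   a time, and the chosen points lie on a common hyperplane iff M i i <> 0 for
   some i < d, in which case row i of M is such a hyperplane. This gives the
   ratio log k / k, slightly better than required. *)
Require Import Defs.
From HB Require Import structures.
From mathcomp Require Import all_boot all_order all_algebra.
From mathcomp Require Import boolp reals sequences exp.
From mathcomp Require Import zify lra.
Set Implicit Arguments. Unset Strict Implicit. Unset Printing Implicit Defensive.
Import Order.TTheory GRing.Theory Num.Theory.
Local Open Scope ring_scope.


(** * A structured language compiled to the machine *)

(** The claim is about concrete machine code, so the running time needs a proof as well as the
    geometry. The program is written in a structured language in which one number [F] bounds the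
    rounds of every loop. As the program is fixed, its cost is polynomial in [F], and the time bound
    reduces to checking that [F = 4 * (d + k).+1] exceeds each loop count.

    Projectors replace Gaussian elimination because they need no pivots: a dependent point simply
    yields a zero update, and the invariant speaks of orthogonality alone. A vector [(a, b)] is
    orthogonal to [(p, -1)] iff [p] lies on the hyperplane given by [a] and [b], so the hyperplanes
    through the chosen points are the vectors fixed by [M] with [a != 0]. Since [M] is symmetric and
    idempotent, [M i i] is the squared length of row [i]. The last index is left out of the test
    because its row may have a zero normal part. *)

Record memory (R : realType) := Memory { nr : nat -> nat; xr : nat -> R }.

Inductive cmd : Type :=
| Base (b : instr)
| Seq (c1 c2 : cmd)
| IfN (i j : nat) (c1 c2 : cmd)
| IfX (i j : nat) (c1 c2 : cmd)
| While (i j : nat) (c : cmd).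

(** Jumps and [Halt] have no value here: control flow comes from the constructors of [cmd] alone, so
    a base instruction always falls through to the next one. *)
Definition base_eval (R : realType) (b : instr) (s : memory R) : option (memory R) :=
  match b with
  | NSet i c => Some (Memory (upd (nr s) i c) (xr s))
  | NAdd i j l => Some (Memory (upd (nr s) i (nr s j + nr s l)%N) (xr s))
  | NSub i j l => Some (Memory (upd (nr s) i (nr s j - nr s l)%N) (xr s))
  | XZero i => Some (Memory (nr s) (upd (xr s) i 0))
  | XOne i => Some (Memory (nr s) (upd (xr s) i 1))
  | XAdd i j l => Some (Memory (nr s) (upd (xr s) i (xr s j + xr s l)))
  | XSub i j l => Some (Memory (nr s) (upd (xr s) i (xr s j - xr s l)))
  | XMul i j l => Some (Memory (nr s) (upd (xr s) i (xr s j * xr s l)))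
  | XDiv i j l => Some (Memory (nr s) (upd (xr s) i (xr s j / xr s l)))
  | XLoad i j => Some (Memory (nr s) (upd (xr s) i (xr s (nr s j))))
  | XStore i j => Some (Memory (nr s) (upd (xr s) (nr s i) (xr s j)))
  | _ => None
  end.

Fixpoint loop (R : realType) (body : memory R -> option (memory R)) (i j n : nat)
    (s : memory R) : option (memory R) :=
  if (nr s i < nr s j)%N then
    if n is n'.+1 then obind (loop body i j n') (body s) else None
  else Some s.

(* Every execution of a loop is allowed at most [F] rounds. *)
Fixpoint eval (R : realType) (F : nat) (c : cmd) (s : memory R) : option (memory R) :=
  match c with
  | Base b => base_eval b s
  | Seq c1 c2 => obind (eval F c2) (eval F c1 s)
  | IfN i j c1 c2 => if (nr s i < nr s j)%N then eval F c1 s else eval F c2 s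
  | IfX i j c1 c2 => if xr s i == xr s j then eval F c1 s else eval F c2 s
  | While i j c => loop (eval F c) i j F s
  end.

(** Jump targets are absolute, hence the offset. The second branch of a conditional is laid out
    first, because the machine jumps when the test holds. *)
Fixpoint compile (off : nat) (c : cmd) : seq instr :=
  match c with
  | Base b => [:: b]
  | Seq c1 c2 =>
      let p1 := compile off c1 in p1 ++ compile (off + size p1) c2
  | IfN i j c1 c2 =>
      let p2 := compile off.+1 c2 in
      let o1 := (off + size p2).+2 in
      let p1 := compile o1 c1 in
      JNLt i j o1 :: p2 ++ Jmp (o1 + size p1) :: p1
  | IfX i j c1 c2 =>
      let p2 := compile off.+1 c2 in
      let o1 := (off + size p2).+2 in
      let p1 := compile o1 c1 in
      JXEq i j o1 :: p2 ++ Jmp (o1 + size p1) :: p1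
  | While i j c =>
      let p := compile off.+2 c in
      [:: JNLt i j off.+2, Jmp (off + size p).+3 & p ++ [:: Jmp off]]
  end.

Fixpoint cost (F : nat) (c : cmd) : nat :=
  match c with
  | Base _ => 1
  | Seq c1 c2 => cost F c1 + cost F c2
  | IfN _ _ c1 c2 | IfX _ _ c1 c2 => (cost F c1 + cost F c2).+2
  | While _ _ c => (F * (cost F c).+2).+2
  end.

(** Each loop contributes one factor [F], so the exponent depends only on the program text. Adding
    the exponents in a sequence is wasteful but dominates both parts. *)
Lemma cost_poly (c : cmd) :
  exists a e, forall F, (cost F c <= a * F.+1 ^ e)%N.
Proof.
have mono a e1 e2 F : (e1 <= e2)%N -> (a * F.+1 ^ e1 <= a * F.+1 ^ e2)%N.
  by move=> le12; rewrite leq_mul2l leq_pexp2l ?orbT.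
have pos e F : (0 < F.+1 ^ e)%N by rewrite expn_gt0.
elim: c => [b|c1 [a1 [e1 H1]] c2 [a2 [e2 H2]]|i j c1 [a1 [e1 H1]] c2 [a2 [e2 H2]]
  |i j c1 [a1 [e1 H1]] c2 [a2 [e2 H2]]|i j c [a [e H]]] /=.
- by exists 1%N, 0%N.
- exists (a1 + a2)%N, (e1 + e2)%N => F; rewrite mulnDl leq_add //.
    by rewrite (leq_trans (H1 F)) // mono // leq_addr.
  by rewrite (leq_trans (H2 F)) // mono // leq_addl.
- exists (a1 + a2 + 2)%N, (e1 + e2)%N => F.
  move: (H1 F) (H2 F) (mono a1 e1 (e1 + e2)%N F (leq_addr _ _)).
  move: (mono a2 e2 (e1 + e2)%N F (leq_addl _ _)) (pos (e1 + e2)%N F); lia.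
- exists (a1 + a2 + 2)%N, (e1 + e2)%N => F.
  move: (H1 F) (H2 F) (mono a1 e1 (e1 + e2)%N F (leq_addr _ _)).
  move: (mono a2 e2 (e1 + e2)%N F (leq_addl _ _)) (pos (e1 + e2)%N F); lia.
- exists (a + 4)%N, e.+1 => F; move: (H F) (pos e F); rewrite expnS; nia.
Qed.

(** * Correctness of the compiler *)

Inductive reach (R : realType) (p : seq instr) : nat -> state R -> state R -> Prop :=
| reach0 s : reach p 0 s s
| reachS n s s1 s2 : step p s = Some s1 -> reach p n s1 s2 -> reach p n.+1 s s2.

Lemma reach_trans (R : realType) p n m (s1 s2 s3 : state R) :
  reach p n s1 s2 -> reach p m s2 s3 -> reach p (n + m) s1 s3.
Proof.
by elim=> [//|k s s' s'' st _ IH] r; rewrite addSn; apply: reachS st (IH r).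
Qed.

(** [run] tests for halting before it consumes fuel, so fuel [n] suffices for [n] steps into a
    halted state. *)
Lemma reach_run (R : realType) p n m (s1 s2 : state R) :
  reach p n s1 s2 -> step p s2 = None -> (n <= m)%N -> run p m s1 = Some s2.
Proof.
move=> r; elim: r m => [s|k s s' s'' st _ IH] m hs.
  by case: m => [|m] _ /=; rewrite hs.
by case: m => [//|m] ltm /=; rewrite st; apply: IH.
Qed.

Definition code_at (p : seq instr) (off : nat) (q : seq instr) : Prop :=
  exists p1 p2, p = p1 ++ q ++ p2 /\ size p1 = off.

Lemma code_atL p off q1 q2 : code_at p off (q1 ++ q2) -> code_at p off q1.
Proof. by move=> [p1 [p2 [-> <-]]]; exists p1, (q2 ++ p2); rewrite !catA. Qed.

Lemma code_atR p off q1 q2 :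
  code_at p off (q1 ++ q2) -> code_at p (off + size q1)%N q2.
Proof.
move=> [p1 [p2 [-> <-]]]; exists (p1 ++ q1), p2.
by rewrite size_cat !catA.
Qed.

Lemma code_at_hd p off b q :
  code_at p off (b :: q) -> nth Halt p off = b /\ code_at p off.+1 q.
Proof.
move=> H; split; last by move: (@code_atR p off [:: b] q H); rewrite addn1.
by case: H => [p1 [p2 [-> <-]]]; rewrite nth_cat ltnn subnn.
Qed.

Definition st_of (R : realType) (q : nat) (s : memory R) : state R :=
  State q (nr s) (xr s).

Lemma compile_correct (R : realType) F p c off (s s' : memory R) :
  eval F c s = Some s' -> code_at p off (compile off c) ->
  exists2 n, (n <= cost F c)%N &
    reach p n (st_of off s) (st_of (off + size (compile off c)) s').
Proof.
elim: c off s s' => [b|c1 IH1 c2 IH2|i j c1 IH1 c2 IH2|i j c1 IH1 c2 IH2|i j c IH]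
  off s s' /=.
- move=> E /code_at_hd [nb _]; exists 1%N => //; rewrite addn1.
  case: s E => N X /= E; apply: reachS (reach0 _ _); rewrite /step /st_of nb /=.
  by case: b E {nb} => //= > [<-].
- case E1: (eval F c1 s) => [s1|] //= E2 cp.
  have [n1 le1 r1] := IH1 _ _ _ E1 (code_atL cp).
  have [n2 le2 r2] := IH2 _ _ _ E2 (code_atR cp).
  exists (n1 + n2)%N; first by rewrite leq_add.
  by rewrite size_cat addnA; apply: reach_trans r1 r2.
- move=> E /code_at_hd [nb cp]; have cp2 := code_atL cp.
  have /code_at_hd [nj cp1] := code_atR cp.
  case: ifP E => c E.
    rewrite -addSn addSn in cp1.
    have [n le r] := IH1 _ _ _ E cp1.
    exists n.+1; first lia.
    apply: reachS; first by rewrite /step /st_of nb c.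
    rewrite /= size_cat /=; set x := (off + size (compile off.+1 c2)).+2 in r *.
    by rewrite (_ : (off + _)%N = (x + size (compile x c1))%N) // /x; lia.
  have [n le r] := IH2 _ _ _ E cp2.
  exists (n + 1).+1; first lia.
  apply: reachS; first by rewrite /step /st_of nb c.
  apply: reach_trans r _; apply: reachS (reach0 _ _).
  rewrite /step /= nj /st_of size_cat /=; congr (Some (State _ _ _)); lia.
- move=> E /code_at_hd [nb cp]; have cp2 := code_atL cp.
  have /code_at_hd [nj cp1] := code_atR cp.
  case: ifP E => c E.
    rewrite -addSn addSn in cp1.
    have [n le r] := IH1 _ _ _ E cp1.
    exists n.+1; first lia.
    apply: reachS; first by rewrite /step /st_of nb c.
    rewrite /= size_cat /=; set x := (off + size (compile off.+1 c2)).+2 in r *.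
    by rewrite (_ : (off + _)%N = (x + size (compile x c1))%N) // /x; lia.
  have [n le r] := IH2 _ _ _ E cp2.
  exists (n + 1).+1; first lia.
  apply: reachS; first by rewrite /step /st_of nb c.
  apply: reach_trans r _; apply: reachS (reach0 _ _).
  rewrite /step /= nj /st_of size_cat /=; congr (Some (State _ _ _)); lia.
- move=> E /code_at_hd [nb /code_at_hd [nj cp]].
  have cpb := code_atL cp; have /code_at_hd [nl _] := code_atR cp.
  rewrite size_cat /=; set e := (off + _)%N.
  (* The number of rounds left is separated from the [F] that bounds the loops inside the body,
     which must stay fixed in the induction. *)
  suff L : forall m t, loop (eval F c) i j m t = Some s' ->
    exists2 n, (n <= (m * (cost F c).+2).+2)%N &
      reach p n (st_of off t) (st_of e s') by exact: L E.
  elim=> [|m IHm] t /=; case: ifP => [c1|c1] //.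
  + move=> [<-]; exists 2%N => //.
    apply: reachS; first by rewrite /step /st_of nb c1.
    apply: reachS (reach0 _ _); rewrite /step nj.
    by congr (Some (State _ _ _)); rewrite /e; lia.
  + case Et: (eval F c t) => [t1|] //= El.
    have [n1 le1 r1] := IH _ _ _ Et cpb.
    have [n2 le2 r2] := IHm _ El.
    exists (n1 + n2.+1).+1; first by rewrite mulSn; lia.
    apply: reachS; first by rewrite /step /st_of nb c1.
    apply: reach_trans r1 _; apply: reachS r2.
    by rewrite /step /= nl.
  + move=> [<-]; exists 2%N; first lia.
    apply: reachS; first by rewrite /step /st_of nb c1.
    apply: reachS (reach0 _ _); rewrite /step nj.
    by congr (Some (State _ _ _)); rewrite /e; lia.
Qed.

Lemma run_compile (R : realType) F c m (s : state R) s' :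
  pc s = 0%N -> eval F c (Memory (nreg s) (xreg s)) = Some s' -> (cost F c <= m)%N ->
  run (compile 0 c) m s = Some (st_of (size (compile 0 c)) s').
Proof.
case: s => q N X /= -> E le.
have [|n len r] := compile_correct (p := compile 0 c) (off := 0) E.
  by exists [::], [::]; rewrite cats0.
apply: reach_run r _ (leq_trans len le).
(* The program counter is just past the code, where [nth] returns the default [Halt]. *)
by rewrite /step /= nth_default.
Qed.

(** * Total-correctness rules *)

(** Termination with at most [F] rounds per loop execution is part of the assertion, so every
    correctness proof also yields the cost bound. *)
Definition wp (R : realType) (F : nat) (c : cmd) (Q : memory R -> Prop) (s : memory R) : Prop :=
  exists2 s', eval F c s = Some s' & Q s'.

(** Only natural registers have a syntactic frame: [XStore] computes its target at run time, so
    frames for real registers have to appear in postconditions. *)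
Fixpoint nwrites (c : cmd) : seq nat :=
  match c with
  | Base (NSet i _) | Base (NAdd i _ _) | Base (NSub i _ _) => [:: i]
  | Base _ => [::]
  | Seq c1 c2 | IfN _ _ c1 c2 | IfX _ _ c1 c2 => nwrites c1 ++ nwrites c2
  | While _ _ c => nwrites c
  end.

Lemma eval_frame (R : realType) F c (s s' : memory R) i :
  eval F c s = Some s' -> i \notin nwrites c -> nr s' i = nr s i.
Proof.
elim: c s s' => [b|c1 IH1 c2 IH2|a b c1 IH1 c2 IH2|a b c1 IH1 c2 IH2|a b c IH] s s' /=.
- by case: s => N X; case: b => //= > [<-] //=; rewrite mem_seq1 /upd; case: eqP.
- case E1: (eval F c1 s) => [s1|] //= E2; rewrite mem_cat negb_or => /andP[n1 n2].
  by rewrite (IH2 _ _ E2 n2) (IH1 _ _ E1 n1).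
- by rewrite mem_cat negb_or => E /andP[n1 n2]; case: ifP E => _ E; [apply: IH1 E n1|apply: IH2 E n2].
- by rewrite mem_cat negb_or => E /andP[n1 n2]; case: ifP E => _ E; [apply: IH1 E n1|apply: IH2 E n2].
- move=> + ni; move: {2}F => m; elim: m s => [|m IHm] s /=; case: ifP => // _; try by move=> [<-].
  by case E1: (eval F c s) => [s1|] //= E2; rewrite (IHm _ E2) (IH _ _ E1 ni).
Qed.

Lemma wp_seq (R : realType) F c1 c2 (Q : memory R -> Prop) s :
  wp F c1 (wp F c2 Q) s -> wp F (Seq c1 c2) Q s.
Proof. by move=> [s1 E1 [s2 E2 q]]; exists s2 => //=; rewrite E1. Qed.

Lemma wp_mono (R : realType) F c (Q1 Q2 : memory R -> Prop) s :
  wp F c Q1 s ->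
  (forall s', Q1 s' -> (forall i, i \notin nwrites c -> nr s' i = nr s i) -> Q2 s') ->
  wp F c Q2 s.
Proof.
move=> [s' E q] H; exists s' => //; apply: H => // i; exact: eval_frame E.
Qed.

Lemma wp_ifN (R : realType) F i j c1 c2 (Q : memory R -> Prop) s :
  ((nr s i < nr s j)%N -> wp F c1 Q s) -> (~~ (nr s i < nr s j)%N -> wp F c2 Q s) ->
  wp F (IfN i j c1 c2) Q s.
Proof.
move=> H1 H2; case lt: (nr s i < nr s j)%N.
  by have [s' E q] := H1 lt; exists s' => //=; rewrite lt.
by have [s' E q] := H2 (negbT lt); exists s' => //=; rewrite lt.
Qed.

Lemma wp_ifX (R : realType) F i j c1 c2 (Q : memory R -> Prop) s :
  (xr s i = xr s j -> wp F c1 Q s) -> (xr s i <> xr s j -> wp F c2 Q s) ->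
  wp F (IfX i j c1 c2) Q s.
Proof.
move=> H1 H2; case: (eqVneq (xr s i) (xr s j)) => e.
  by have [s' E q] := H1 e; exists s' => //=; rewrite e eqxx.
by have [s' E q] := H2 (elimN eqP e); exists s' => //=; rewrite (negPf e).
Qed.

(** The invariant is indexed by the rounds done, out of exactly [n]. The frame of the body is handed
    to each premise, so invariants need not mention untouched registers. *)
Lemma wp_while (R : realType) F i b c n (I : nat -> memory R -> Prop) (Q : memory R -> Prop) s :
  (n <= F)%N -> I 0%N s ->
  (forall m s', (m < n)%N -> I m s' ->
     (forall r, r \notin nwrites c -> nr s' r = nr s r) ->
     (nr s' i < nr s' b)%N /\ wp F c (I m.+1) s') ->
  (forall s', I n s' -> (forall r, r \notin nwrites c -> nr s' r = nr s r) ->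
     ~~ (nr s' i < nr s' b)%N /\ Q s') ->
  wp F (While i b c) Q s.
Proof.
move=> nF I0 IS IQ.
suff L : forall f m s', (n - m <= f)%N -> (m <= n)%N -> I m s' ->
    (forall r, r \notin nwrites c -> nr s' r = nr s r) ->
    exists2 s2, loop (eval F c) i b f s' = Some s2 & Q s2.
  by have [|s2 E q] := L F 0%N s _ (leq0n _) I0 (fun _ _ => erefl);
    [rewrite subn0 | exists s2].
elim=> [|f IHf] m s' lef lem Im fr.
  have em : m = n by lia.
  by rewrite em in Im; have [/negPf nlt q] := IQ _ Im fr; exists s' => //=; rewrite nlt.
case: (ltnP m n) => lt; last first.
  have em : m = n by lia.
  by rewrite em in Im; have [/negPf nlt q] := IQ _ Im fr; exists s' => //=; rewrite nlt.
have [ltb [s1 E1 I1]] := IS _ _ lt Im fr.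
have [|r nw|s2 E2 q] := IHf m.+1 s1 _ lt I1.
- lia.
- by rewrite (eval_frame E1 nw) fr.
by exists s2 => //=; rewrite ltb E1.
Qed.

(** * Orthogonal projectors *)

Definition dot (R : realType) n (u v : 'cV[R]_n) : R := (u^T *m v) 0 0.

(* If [v] already lies in the span, then [M *m v = 0] and the inverse of [0] is
   [0], so that no case distinction is needed. *)
Definition proj_step (R : realType) n (M : 'M[R]_n) (v : 'cV[R]_n) : 'M[R]_n :=
  M - (dot (M *m v) v)^-1 *: ((M *m v) *m (M *m v)^T).

(* [M] is the orthogonal projector onto the complement of the span of [V]. *)
Definition projector (R : realType) n (M : 'M[R]_n) (V : 'cV[R]_n -> Prop) : Prop :=
  [/\ M^T = M, M *m M = M, forall v, V v -> M *m v = 0 &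
      forall u, (forall v, V v -> dot v u = 0) -> M *m u = u].

Lemma dotE (R : realType) n (u v : 'cV[R]_n) : u^T *m v = (dot u v)%:M.
Proof. by rewrite [LHS]mx11_scalar. Qed.

Lemma dotC (R : realType) n (u v : 'cV[R]_n) : dot u v = dot v u.
Proof. by rewrite /dot -[v in LHS]trmxK -trmx_mul mxE. Qed.

Lemma dot_sum (R : realType) n (u v : 'cV[R]_n) : dot u v = \sum_i u i 0 * v i 0.
Proof. by rewrite /dot mxE; apply: eq_bigr => i _; rewrite mxE. Qed.

Lemma dot_eq0 (R : realType) n (u : 'cV[R]_n) : dot u u = 0 -> u = 0.
Proof.
rewrite dot_sum => /eqP; rewrite psumr_eq0 => [/allP H|i _]; last by rewrite -expr2 sqr_ge0.
apply/colP => i; rewrite mxE; apply/eqP.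
by have := H i (mem_index_enum _); rewrite mulf_eq0 orbb.
Qed.

Lemma projector_iff (R : realType) n (M : 'M[R]_n) (V W : 'cV[R]_n -> Prop) :
  (forall v, V v <-> W v) -> projector M V -> projector M W.
Proof.
move=> VW [? ? MV MU]; split=> // [v /VW|u H]; first exact: MV.
by apply: MU => v /VW; exact: H.
Qed.

Lemma projector1 (R : realType) n : projector (1%:M : 'M[R]_n) (fun=> False).
Proof. by split; rewrite ?trmx1 ?mulmx1 // => u _; rewrite mul1mx. Qed.

(** A Gram-Schmidt step: [w = M *m v] is the part of [v] orthogonal to the span, and the update
    removes the direction [w]. The scalar [dot w v] equals [dot w w] because [M] is symmetric and
    idempotent. *)
Lemma proj_stepP (R : realType) n (M : 'M[R]_n) (V W : 'cV[R]_n -> Prop) v :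
  projector M V -> (forall u, W u <-> V u \/ u = v) -> projector (proj_step M v) W.
Proof.
move=> [Ms Mi MV MU] WV; rewrite /proj_step; set w := M *m v; set s := dot w v.
have Mw : M *m w = w by rewrite /w mulmxA Mi.
have swT u : dot w u = dot v (M *m u).
  by rewrite /dot /w trmx_mul Ms mulmxA.
have ww : dot w w = s by rewrite swT Mw dotC.
have E u : w *m w^T *m u = dot w u *: w.
  by rewrite -mulmxA dotE mul_mx_scalar.
have wM : w^T *m M = w^T by rewrite -{1}Ms -trmx_mul Mw.
(* Positive definiteness over the reals: a vanishing denominator means that [v] is dependent and the
   update is zero. *)
have s0 : s = 0 -> w = 0 by rewrite -ww; apply: dot_eq0.
split.
- by rewrite linearB /= linearZ /= trmx_mul trmxK Ms.
- have MW : M *m (w *m w^T) = w *m w^T by rewrite mulmxA Mw.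
  have WM : (w *m w^T) *m M = w *m w^T by rewrite -mulmxA wM.
  have WW : (w *m w^T) *m (w *m w^T) = s *: (w *m w^T) by rewrite mulmxA E ww scalemxAl.
  rewrite mulmxBl !mulmxBr Mi -!scalemxAr -!scalemxAl MW WM WW.
  case: (eqVneq s 0) => [/s0 ->|sn]; first by rewrite !mul0mx !scaler0 !subr0.
  by rewrite [s^-1 *: (s *: _)]scalerA mulVf // scale1r subrr subr0.
- move=> u /WV [Vu|->]; rewrite mulmxBl -scalemxAl E.
    by rewrite swT MV // /dot mulmx0 mxE scale0r scaler0 subr0.
  rewrite -/w -/s; case: (eqVneq s 0) => [/s0 ->|sn]; first by rewrite !scaler0 subr0.
  by rewrite scalerA mulVf // scale1r subrr.
- move=> u Hu; have Mu : M *m u = u by apply: MU => x Vx; apply: Hu; apply/WV; left.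
  rewrite mulmxBl -scalemxAl E swT Mu Hu ?scale0r ?scaler0 ?subr0 //.
  by apply/WV; right.
Qed.

Lemma projector_row (R : realType) n (M : 'M[R]_n) (V : 'cV[R]_n -> Prop) i v :
  projector M V -> V v -> \sum_l M i l * v l 0 = 0.
Proof. by move=> [_ _ MV _] /MV /colP /(_ i); rewrite !mxE. Qed.

(** If [M i i], the squared length of row [i], were zero, that row would vanish, and [u = M *m u]
    would have coordinate [i] equal to zero. *)
Lemma projector_diag (R : realType) n (M : 'M[R]_n) (V : 'cV[R]_n -> Prop) u i :
  projector M V -> (forall v, V v -> dot v u = 0) -> u i 0 != 0 -> M i i != 0.
Proof.
move=> [Ms Mi _ MU] /MU Mu; apply: contraNneq => Mii.
have ri : (row i M)^T = 0.
  apply: dot_eq0; rewrite /dot trmxK tr_row Ms.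
  have -> : (row i M *m col i M) 0 0 = (M *m M) i i.
    by rewrite !mxE; apply: eq_bigr => l _; rewrite !mxE.
  by rewrite Mi.
rewrite -Mu; have -> : (M *m u) i 0 = (row i M *m u) 0 0 by rewrite -row_mul [RHS]mxE.
by rewrite -[row i M]trmxK ri trmx0 mul0mx mxE.
Qed.

(** * Enumeration of subsets by doubling *)

(* Bits are read from the top by doubling modulo [T], as the machine has no
   halving. *)
Definition dbl (T r : nat) : nat := if (r + r < T)%N then (r + r)%N else (r + r - T)%N.

(** For [T = 2 ^ t] and [m < T] this is the binary digit of [m] of weight [2 ^ (t - 1 - j)]. *)
Definition bit (T m j : nat) : bool := (T <= (iter j (dbl T) m).*2)%N.

Lemma dbl_double T r : dbl T.*2 r.*2 = (dbl T r).*2.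
Proof. rewrite /dbl; case: ltnP => ?; case: ltnP => ?; lia. Qed.

Lemma iter_dbl_double T r j : iter j (dbl T.*2) r.*2 = (iter j (dbl T) r).*2.
Proof. by elim: j => //= j ->; rewrite dbl_double. Qed.

(** The value [f 0] becomes the leading digit. One doubling discards it and leaves twice the number
    found for the shifted function, and scaling number and modulus by two preserves the digits. *)
Lemma bit_surj t (f : nat -> bool) :
  exists2 m, (m < 2 ^ t)%N & forall j, (j < t)%N -> bit (2 ^ t) m j = f j.
Proof.
elim: t f => [|t IH] f; first by exists 0%N.
have [m lt H] := IH (fun j => f j.+1).
exists (f 0%N * 2 ^ t + m)%N.
  by rewrite expnS; case: (f 0%N); lia.
rewrite expnS mul2n => -[_|j ltj].
  by rewrite /bit /=; case: (f 0%N); lia.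
rewrite -H // /bit iterSr (_ : dbl _ _ = m.*2).
  by rewrite iter_dbl_double leq_double.
by rewrite /dbl; case: (f 0%N); case: ltnP => ?; lia.
Qed.

(** * Rules for single instructions *)

Lemma wp_base (R : realType) F b (Q : memory R -> Prop) s s' :
  base_eval b s = Some s' -> Q s' -> wp F (Base b) Q s.
Proof. by move=> E q; exists s'. Qed.

Lemma wp_step (R : realType) F b c (Q : memory R -> Prop) s s' :
  base_eval b s = Some s' -> wp F c Q s' -> wp F (Seq (Base b) c) Q s.
Proof. by move=> E q; apply: wp_seq; apply: wp_base E q. Qed.

Coercion Base : instr >-> cmd.
Notation "c1 ;; c2" := (Seq c1 c2) (at level 61, right associativity).

Ltac step := (apply: wp_step || apply: wp_base); [reflexivity|]; rewrite /upd /=.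

Tactic Notation "pull" constr(fr) constr(r) ident(h) :=
  have h := fr r isT; rewrite /upd /= in h.

(** * The machine code of the projection step *)

Definition matof (R : realType) (X : nat -> R) (b e : nat) : 'M[R]_e :=
  \matrix_(i, l) X (b + (i * e + l))%N.

Definition vecof (R : realType) (X : nat -> R) (b e : nat) : 'cV[R]_e :=
  \col_l X (b + l)%N.

Notation r_d := 0%N.
Notation r_k := 1%N.
Notation r_one := 2%N.
Notation r_zero := 3%N.
Notation r_e := 4%N.
Notation r_pts := 5%N.
Notation r_w := 6%N.
Notation r_mat := 7%N.
Notation r_best := 8%N.
Notation r_t := 9%N.
Notation r_T := 10%N.
Notation r_B := 11%N.
Notation r_m := 12%N.
Notation r_grp := 13%N.
Notation r_cnt := 14%N.
Notation r_max := 15%N.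
Notation r_j := 16%N.
Notation r_i := 17%N.
Notation r_l := 18%N.
Notation r_p := 19%N.
Notation r_q := 20%N.
Notation r_y := 21%N.
Notation r_r := 22%N.
Notation r_v := 23%N.
Notation r_u := 24%N.
Notation r_tmp := 25%N.

Definition incr (i : nat) : instr := NAdd i i r_one.
Definition mov (i j : nat) : instr := NAdd i j r_zero.

(** Two passes are needed: the product [w] of matrix and point, and its dot product with the point
    (accumulated in word [4]), must be complete before the matrix is overwritten. *)
Definition proj_w : cmd :=
  mov r_p r_mat ;; mov r_q r_w ;; mov r_u r_v ;; XZero 4 ;; NSet r_i 0 ;;
  While r_i r_e (
    XZero 0 ;; NSet r_l 0 ;; mov r_y r_v ;;
    While r_l r_e (
      XLoad 1 r_p ;; XLoad 2 r_y ;; XMul 1 1 2 ;; XAdd 0 0 1 ;;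
      incr r_p ;; incr r_y ;; incr r_l) ;;
    XStore r_q 0 ;; XLoad 1 r_u ;; XMul 1 0 1 ;; XAdd 4 4 1 ;;
    incr r_q ;; incr r_u ;; incr r_i).

Definition proj_upd : cmd :=
  mov r_p r_mat ;; mov r_q r_w ;; NSet r_i 0 ;;
  While r_i r_e (
    XLoad 3 r_q ;; XDiv 3 3 4 ;; NSet r_l 0 ;; mov r_y r_w ;;
    While r_l r_e (
      XLoad 1 r_y ;; XMul 1 3 1 ;; XLoad 2 r_p ;; XSub 2 2 1 ;; XStore r_p 2 ;;
      incr r_p ;; incr r_y ;; incr r_l) ;;
    incr r_q ;; incr r_i).

Definition prodrow (R : realType) (X : nat -> R) (b v e i : nat) : R :=
  \sum_(0 <= l < e) X (b + (i * e + l))%N * X (v + l)%N.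

(** The chain of inequalities between addresses keeps scratch words, point, work vector and matrix
    disjoint, so no store can spoil a later read. *)
Lemma proj_wP (R : realType) F e aw am v (s : memory R) :
  nr s r_one = 1%N -> nr s r_zero = 0%N -> nr s r_e = e -> nr s r_w = aw ->
  nr s r_mat = am -> nr s r_v = v ->
  (8 <= v)%N -> (v + e <= aw)%N -> (aw + e <= am)%N -> (e <= F)%N ->
  wp F proj_w (fun s' =>
    [/\ forall a, (8 <= a)%N -> ~~ (aw <= a < aw + e)%N -> xr s' a = xr s a,
        forall i, (i < e)%N -> xr s' (aw + i)%N = prodrow (xr s) am v e i &
        xr s' 4 = \sum_(0 <= i < e) prodrow (xr s) am v e i * xr s (v + i)%N]) s.
Proof.
move=> h1 h0 he hw hm hv v8 vw wm eF.
do 5!step; rewrite ?h1 ?h0 ?he ?hw ?hm ?hv ?addn0.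
apply: (@wp_while _ _ _ _ _ e (fun i s' =>
  [/\ [/\ nr s' r_i = i, nr s' r_p = am + i * e, nr s' r_q = aw + i & nr s' r_u = v + i]%N,
     forall a, (8 <= a)%N -> ~~ (aw <= a < aw + e)%N -> xr s' a = xr s a,
     forall i', (i' < i)%N -> xr s' (aw + i')%N = prodrow (xr s) am v e i' &
     xr s' 4 = \sum_(0 <= i' < i) prodrow (xr s) am v e i' * xr s (v + i')%N])) => //=.
- by split=> //; [rewrite mul0n !addn0 | move=> a; case: a => [|[|[|[|[|a]]]]] | rewrite big_geq].
- move=> i s1 ltie [[hi hp hq hu] hX hW h4] fr; split.
    by rewrite hi (fr r_e) //= he.
  pull fr r_one f1; pull fr r_zero f0; pull fr r_e fe; pull fr r_v fv.
  rewrite ?h1 ?h0 ?he ?hv in f1 f0 fe fv.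
  do 3!step; rewrite ?f1 ?f0 ?fv addn0; apply: wp_seq.
  apply: (@wp_while _ _ _ _ _ e (fun l s' =>
    [/\ [/\ nr s' r_l = l, nr s' r_p = am + (i * e + l) & nr s' r_y = v + l]%N,
      forall a, (a = 4)%N \/ (8 <= a)%N -> xr s' a = xr s1 a &
      xr s' 0%N = \sum_(0 <= l' < l) xr s (am + (i * e + l'))%N * xr s (v + l')%N])) => //=.
  + by split; [rewrite !addn0 hp | move=> [|a] //; case | rewrite big_geq].
  + move=> l s2 ltle [[gl gp gy] gX g0] fr2; split.
      by rewrite gl (fr2 r_e) //= fe.
    pull fr2 r_one e1; rewrite f1 in e1.
    do 7!step; rewrite gl gp gy e1 !addn1 -!addnS; split=> //.
      by move=> a a8; do ?[case: eqP => ?; first lia]; exact: gX.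
    rewrite big_nat_recr //= -g0; congr (_ + _ * _).
      by rewrite gX; [rewrite hX //; lia | lia].
    by case: eqP => [|_]; [lia | rewrite gX; [rewrite hX //; lia | lia]].
  + move=> s2 [[gl gp gy] gX g0] fr2; split; first by rewrite gl (fr2 r_e) //= fe ltnn.
    pull fr2 r_one e1; pull fr2 r_q eq; pull fr2 r_u eu; pull fr2 r_i ei.
    rewrite ?f1 ?hi ?hq ?hu in e1 eq eu ei.
    do 7!step; rewrite ei gp eq eu e1 !addn1 -!addnS; split.
    * by rewrite mulSnr.
    * move=> a a8 na; do ?[case: eqP => ?; first lia].
      by rewrite gX ?hX //; right.
    * move=> i' lti'; do ?[case: eqP => ?; first lia].
      case: (ltngtP i' i) => [lt|?|->]; [|lia|].
        by case: eqP => [|_]; [lia|rewrite gX ?hW //; lia].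
      by rewrite eqxx g0.
    * rewrite big_nat_recr //= -h4.
      do ?[case: eqP => ?; first lia].
      by rewrite (gX 4%N) ?g0 ?gX ?(hX (v + i)%N) //; lia.
- move=> s' [[hi hp hq hu] hX hW h4] fr; split=> //.
  by rewrite hi (fr r_e) //= he ltnn.
Qed.

Lemma proj_updP (R : realType) F e aw am (s : memory R) :
  nr s r_one = 1%N -> nr s r_zero = 0%N -> nr s r_e = e -> nr s r_w = aw ->
  nr s r_mat = am -> (8 <= aw)%N -> (aw + e <= am)%N -> (e <= F)%N ->
  wp F proj_upd (fun s' =>
    (forall a, (8 <= a < am)%N -> xr s' a = xr s a) /\
    forall i l, (i < e)%N -> (l < e)%N ->
      xr s' (am + (i * e + l))%N = xr s (am + (i * e + l))%N -
        xr s (aw + i)%N / xr s 4 * xr s (aw + l)%N) s.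
Proof.
move=> h1 h0 he hw hm w8 wm eF.
do 3!step; rewrite ?h1 ?h0 ?he ?hw ?hm ?addn0.
(* Entries are indexed by their linear address [z = i * e + l], so both loop invariants just say
   that the addresses below the current one are updated. *)
pose W z := xr s (am + z)%N -
  xr s (aw + z %/ e)%N / xr s 4 * xr s (aw + z %% e)%N.
apply: (@wp_while _ _ _ _ _ e (fun i s' =>
  [/\ [/\ nr s' r_i = i, nr s' r_p = am + i * e & nr s' r_q = aw + i]%N,
     forall a, (a = 4)%N \/ (8 <= a < am)%N -> xr s' a = xr s a &
     forall z, xr s' (am + z)%N = if (z < i * e)%N then W z else xr s (am + z)%N])) => //=.
- by rewrite mul0n !addn0.
- move=> i s1 ltie [[hi hp hq] hX hW] fr; split.
    by rewrite hi (fr r_e) //= he.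
  pull fr r_one f1; pull fr r_zero f0; pull fr r_e fe; pull fr r_w fw.
  rewrite ?h1 ?h0 ?he ?hw in f1 f0 fe fw.
  do 4!step; rewrite ?f1 ?f0 ?fw ?hq addn0; apply: wp_seq.
  apply: (@wp_while _ _ _ _ _ e (fun l s' =>
    [/\ [/\ nr s' r_l = l, nr s' r_p = am + (i * e + l) & nr s' r_y = aw + l]%N,
      xr s' 3%N = xr s (aw + i)%N / xr s 4,
      forall a, (a = 4)%N \/ (8 <= a < am)%N -> xr s' a = xr s a &
      forall z, xr s' (am + z)%N = if (z < i * e + l)%N then W z else xr s (am + z)%N])) => //=.
  + split; first by rewrite !addn0 hp.
    * by rewrite !hX //; lia.
    * by move=> a a8; do ?[case: eqP => ?; first lia]; rewrite hX //; lia.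
    * by move=> z; do ?[case: eqP => ?; first lia]; rewrite hW addn0.
  + move=> l s2 ltle [[gl gp gy] g3 gX gW] fr2; split.
      by rewrite gl (fr2 r_e) //= fe.
    pull fr2 r_one e1; rewrite f1 in e1.
    do 8!step; rewrite gl gp gy e1 !addn1 -!addnS; split=> //.
    * by do ?[case: eqP => ?; first lia].
    * by move=> a a8; do ?[case: eqP => ?; first lia]; exact: gX.
    * move=> z; rewrite eqn_add2l addnS ltnS (leq_eqVlt z).
      case: (eqVneq z (i * e + l)%N) => [->|nz] /=; last first.
        by do ?[case: eqP => ?; first lia]; exact: gW.
      case: eqP => [|_]; first lia.
      rewrite g3 (gX (aw + l)%N); last lia.
      by rewrite gW ltnn /W divnMDl ?modnMDl ?divn_small ?modn_small ?addn0 //; lia.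
  + move=> s2 [[gl gp gy] g3 gX gW] fr2; split; first by rewrite gl (fr2 r_e) //= fe ltnn.
    pull fr2 r_one e1; pull fr2 r_q eq; pull fr2 r_i ei.
    rewrite ?f1 ?hi ?hq in e1 eq ei.
    do 2!step; rewrite ei gp eq e1 !addn1 -!addnS; split => //.
      by rewrite mulSnr.
    by move=> z; rewrite gW mulSnr.
- move=> s' [[hi hp hq] hX hW] fr; split; first by rewrite hi (fr r_e) //= he ltnn.
  split=> [a a8|i l lti ltl]; first by rewrite hX //; right.
  rewrite hW /W ifT; last nia.
  by rewrite divnMDl ?modnMDl ?divn_small ?modn_small ?addn0 //; lia.
Qed.

Lemma projP (R : realType) F e aw am v (s : memory R) :
  nr s r_one = 1%N -> nr s r_zero = 0%N -> nr s r_e = e -> nr s r_w = aw ->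
  nr s r_mat = am -> nr s r_v = v ->
  (8 <= v)%N -> (v + e <= aw)%N -> (aw + e <= am)%N -> (e <= F)%N ->
  wp F (proj_w ;; proj_upd) (fun s' =>
    (forall a, (8 <= a < aw)%N -> xr s' a = xr s a) /\
    matof (xr s') am e = proj_step (matof (xr s) am e) (vecof (xr s) v e)) s.
Proof.
move=> h1 h0 he hw hm hv v8 vw wm eF; apply: wp_seq.
apply: wp_mono (proj_wP h1 h0 he hw hm hv v8 vw wm eF) _ => s1 [hX hW h4] fr.
have /(_ r_one isT) f1 := fr; have /(_ r_zero isT) f0 := fr; have /(_ r_e isT) fe := fr.
have /(_ r_w isT) fw := fr; have /(_ r_mat isT) fm := fr.
rewrite ?h1 ?h0 ?he ?hw ?hm in f1 f0 fe fw fm.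
apply: wp_mono (proj_updP f1 f0 fe fw fm _ wm eF) _; first lia.
move=> s2 [gX gW] _; split=> [a a8|]; first by rewrite gX ?hX //; lia.
have prodE (i : 'I_e) : (matof (xr s) am e *m vecof (xr s) v e) i 0 = prodrow (xr s) am v e i.
  by rewrite mxE /prodrow big_mkord; apply: eq_bigr => l _; rewrite !mxE.
apply/matrixP => i l; rewrite /proj_step !mxE gW // !hW // h4 hX; [|lia..].
congr (_ - _); rewrite -mulrA mulrCA big_ord1 !mxE.
have sumE (j : 'I_e) :
    \sum_l matof (xr s) am e j l * vecof (xr s) v e l 0 = prodrow (xr s) am v e j.
  by rewrite -prodE mxE.
rewrite !sumE; congr (_^-1 * _); rewrite dot_sum big_mkord.
by apply: eq_bigr => j _; rewrite prodE mxE.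
Qed.

(* Registers [0] to [10] during the search. Memory layout: the points in
   homogeneous coordinates with stride [e] at [A], then the best hyperplane so
   far, a work vector and the projector. The words below [8] are scratch. *)
Definition regs (d k A t : nat) : seq nat :=
  let e := (d + 1)%N in let ab := (A + k * e)%N in
  [:: d; k; 1; 0; e; A; ab + e; ab + e + e; ab; t; 2 ^ t]%N.

Definition env (d k A t : nat) (N : nat -> nat) : Prop :=
  forall r, (r < 11)%N -> N r = nth 0%N (regs d k A t) r.

Lemma env_frame d k A t (N N' : nat -> nat) w :
  env d k A t N -> (forall r, r \notin w -> N' r = N r) ->
  all (leq 11) w -> env d k A t N'.
Proof.
move=> es fr /allP H r lt; rewrite fr ?es //.
by apply/negP => /H; rewrite leqNgt lt.
Qed.

Ltac env_solve E :=
  let r := fresh "r" in let lt := fresh "lt" in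
  move=> r lt /=; do ?[case: eqP => ?; first lia]; exact: E.

(** * Initialising the projector and scanning its diagonal *)

Definition init_mat : cmd :=
  mov r_p r_mat ;; NSet r_i 0 ;;
  While r_i r_e (
    NSet r_l 0 ;;
    While r_l r_e (
      IfN r_i r_l (XZero 0) (IfN r_l r_i (XZero 0) (XOne 0)) ;;
      XStore r_p 0 ;; incr r_p ;; incr r_l) ;;
    incr r_i).

Lemma init_matP (R : realType) F d k A t (s : memory R) :
  env d k A t (nr s) -> (8 <= A)%N -> (d + 1 <= F)%N ->
  let am := nth 0%N (regs d k A t) r_mat in
  wp F init_mat (fun s' =>
    (forall a, (8 <= a < am)%N -> xr s' a = xr s a) /\
    matof (xr s') am (d + 1) = 1%:M) s.
Proof.
move=> es A8 eF am; set e := (d + 1)%N in eF *.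
have am8 : (8 <= am)%N by rewrite /am /=; lia.
have h1 := es r_one isT; have h0 := es r_zero isT; have he := es r_e isT.
have hm := es r_mat isT; rewrite /= in h1 h0 he hm.
rewrite -/e in he; rewrite -[RHS]/am in hm; clearbody e am.
do 2!step; rewrite ?h1 ?h0 ?he ?hm ?addn0.
pose W z : R := (z %/ e == z %% e)%N%:R.
apply: (@wp_while _ _ _ _ _ e (fun i s' =>
  [/\ (nr s' r_i = i /\ nr s' r_p = am + i * e)%N,
     forall a, (8 <= a < am)%N -> xr s' a = xr s a &
     forall z, (z < i * e)%N -> xr s' (am + z)%N = W z])) => //=.
- by rewrite mul0n !addn0.
- move=> i s1 ltie [[hi hp] hX hW] fr; split.
    by rewrite hi (fr r_e) //= he.
  pull fr r_one f1; pull fr r_e fe.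
  rewrite ?h1 ?he in f1 fe.
  do 1!step; apply: wp_seq.
  apply: (@wp_while _ _ _ _ _ e (fun l s' =>
    [/\ (nr s' r_l = l /\ nr s' r_p = am + (i * e + l))%N,
      forall a, (8 <= a < am)%N -> xr s' a = xr s a &
      forall z, (z < i * e + l)%N -> xr s' (am + z)%N = W z])) => //=.
  + by rewrite addn0.
  + move=> l s2 ltle [[gl gp] gX gW] fr2; split.
      by rewrite gl (fr2 r_e) //= fe.
    pull fr2 r_one e1; rewrite f1 in e1; pull fr2 r_i ei; rewrite hi in ei.
    have Wil : W (i * e + l)%N = (i == l)%:R.
      by rewrite /W divnMDl ?modnMDl ?divn_small ?modn_small ?addn0 //; lia.
    apply: wp_seq; set Q := (Q in wp F _ Q).
    (* The branches differ only in the value left in word [0], so the rest of the round is verified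
       once. *)
    have HQ x : x = W (i * e + l)%N -> Q (Memory (nr s2) (upd (xr s2) 0%N x)).
      move=> xE; rewrite /Q.
      do 3!step; rewrite gl gp e1 !addn1 -!addnS; split=> //.
        by move=> a a8; do ?[case: eqP => ?; first lia]; exact: gX.
      move=> z; rewrite addnS ltnS (leq_eqVlt z) eqn_add2l.
      by case: (eqVneq z (i * e + l)%N) => [->|nz] //= lt; case: eqP => ?; [lia | exact: gW].
    apply: wp_ifN => [|nlt]; last apply: wp_ifN => [|nlt2].
    * rewrite ei gl => lt; apply: wp_base; [reflexivity | apply: HQ].
      by rewrite Wil; case: eqP => // ?; lia.
    * rewrite ei gl => lt; apply: wp_base; [reflexivity | apply: HQ].
      by rewrite Wil; case: eqP => // ?; lia.
    * rewrite ei gl in nlt nlt2; apply: wp_base; [reflexivity | apply: HQ].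
      by rewrite Wil; case: eqP => // ?; lia.
  + move=> s2 [[gl gp] gX gW] fr2; split; first by rewrite gl (fr2 r_e) //= fe ltnn.
    pull fr2 r_one e1; pull fr2 r_i ei.
    rewrite ?f1 ?hi in e1 ei.
    by do 1!step; rewrite ei gp e1 addn1 mulSnr.
- move=> s' [[hi hp] hX hW] fr; split; first by rewrite hi (fr r_e) //= he ltnn.
  split=> [a a8|]; first by rewrite hX.
  apply/matrixP => i l; rewrite !mxE hW; last by case: i l => i Hi [l Hl] /=; nia.
  have lte := ltn_ord l.
  by rewrite /W divnMDl ?modnMDl ?divn_small ?modn_small ?addn0 //; lia.
Qed.

Definition copy_row : cmd :=
  mov r_q r_p ;; mov r_y r_best ;; NSet r_l 0 ;;
  While r_l r_e (
    XLoad 0 r_q ;; XStore r_y 0 ;; incr r_q ;; incr r_y ;; incr r_l).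

(** The frame starts at [0 < a] because [scan] keeps the zero of its comparisons in word [1]. *)
Lemma copy_rowP (R : realType) F d k A t (s : memory R) p :
  env d k A t (nr s) -> (8 <= A)%N -> (d + 1 <= F)%N ->
  let ab := nth 0%N (regs d k A t) r_best in
  nr s r_p = p -> (ab + (d + 1) <= p)%N ->
  wp F copy_row (fun s' =>
    (forall a, (0 < a)%N -> ~~ (ab <= a < ab + (d + 1))%N -> xr s' a = xr s a) /\
    (forall l, (l < d + 1)%N -> xr s' (ab + l)%N = xr s (p + l)%N)) s.
Proof.
move=> es A8 eF ab hp lep; set e := (d + 1)%N in eF lep *.
have ab8 : (8 <= ab)%N by rewrite /ab /=; lia.
have h1 := es r_one isT; have h0 := es r_zero isT; have he := es r_e isT.
have hb := es r_best isT; rewrite /= in h1 h0 he hb.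
rewrite -/e in he; rewrite -[RHS]/ab in hb; clearbody e ab.
do 3!step; rewrite ?h1 ?h0 ?he ?hb ?hp ?addn0.
apply: (@wp_while _ _ _ _ _ e (fun l s' =>
  [/\ [/\ nr s' r_l = l, nr s' r_q = p + l & nr s' r_y = ab + l]%N,
     forall a, (0 < a)%N -> ~~ (ab <= a < ab + e)%N -> xr s' a = xr s a &
     forall l', (l' < l)%N -> xr s' (ab + l')%N = xr s (p + l')%N])) => //=.
- by rewrite !addn0.
- move=> l s1 ltle [[hl hq hy] hX hW] fr; split.
    by rewrite hl (fr r_e) //= he.
  pull fr r_one f1; rewrite h1 in f1.
  do 5!step; rewrite hl hq hy f1 !addn1 -!addnS; split=> //.
    by move=> a a0 na; do ?[case: eqP => ?; first lia]; exact: hX.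
  move=> l'; rewrite eqn_add2l ltnS (leq_eqVlt l').
  case: (eqVneq l' l) => [->|nl] /=; first by move=> _; apply: hX; lia.
  by move=> lt; do ?[case: eqP => ?; first lia]; exact: hW.
- move=> s' [[hl hq hy] hX hW] fr; split; first by rewrite hl (fr r_e) //= he ltnn.
  by [].
Qed.

(** In the branches that do nothing, [XZero 0] serves as the empty command, since word [0] is
    scratch. *)
Definition scan : cmd :=
  mov r_p r_mat ;; NSet r_i 0 ;; XZero 1 ;;
  While r_i r_d (
    NAdd r_q r_p r_i ;; XLoad 0 r_q ;;
    IfX 0 1 (XZero 0) (
      IfN r_max r_cnt (copy_row ;; mov r_max r_cnt) (XZero 0)) ;;
    NAdd r_p r_p r_e ;; incr r_i).

Lemma scanP (R : realType) F d k A t (s : memory R) :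
  env d k A t (nr s) -> (8 <= A)%N -> (d + 1 <= F)%N ->
  let ab := nth 0%N (regs d k A t) r_best in
  let M := matof (xr s) (nth 0%N (regs d k A t) r_mat) (d + 1) in
  wp F scan (fun s' =>
    [/\ forall a, (8 <= a)%N -> ~~ (ab <= a < ab + (d + 1))%N -> xr s' a = xr s a &
      [/\ nr s' r_max = nr s r_max, forall a, (8 <= a)%N -> xr s' a = xr s a &
        forall i : 'I_d, M (lshift 1 i) (lshift 1 i) != 0 ->
          (nr s r_cnt <= nr s r_max)%N] \/
      [/\ (nr s r_max < nr s r_cnt)%N, nr s' r_max = nr s r_cnt &
        exists i : 'I_d, M (lshift 1 i) (lshift 1 i) != 0 /\
          forall l : 'I_(d + 1), xr s' (ab + l)%N = M (lshift 1 i) l]]) s.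
Proof.
move=> es A8 eF ab M; pose am := nth 0%N (regs d k A t) r_mat; pose e := (d + 1)%N.
have abm : (8 <= ab /\ ab + e + e = am)%N by rewrite /ab /am /e /=; lia.
have h0 := es r_zero isT; have hd := es r_d isT; have hm := es r_mat isT.
rewrite /= in h0 hd hm; rewrite -/e -/ab -[RHS]/am in hm.
do 3!step; rewrite ?h0 ?hm ?addn0.
apply: (@wp_while _ _ _ _ _ d (fun i s' =>
  [/\ [/\ nr s' r_i = i, nr s' r_p = am + i * e & nr s' r_cnt = nr s r_cnt]%N,
    xr s' 1%N = 0,
    forall a, (8 <= a)%N -> ~~ (ab <= a < ab + e)%N -> xr s' a = xr s a &
      [/\ nr s' r_max = nr s r_max, forall a, (8 <= a)%N -> xr s' a = xr s a &
        forall i' : 'I_d, (i' < i)%N -> M (lshift 1 i') (lshift 1 i') != 0 ->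
          (nr s r_cnt <= nr s r_max)%N] \/
      [/\ (nr s r_max < nr s r_cnt)%N, nr s' r_max = nr s r_cnt &
        exists i : 'I_d, M (lshift 1 i) (lshift 1 i) != 0 /\
          forall l : 'I_(d + 1), xr s' (ab + l)%N = M (lshift 1 i) l]])) => //=.
- lia.
- rewrite mul0n addn0; split=> //.
    by move=> a a8 _; case: eqP => // ?; lia.
  by left; split=> // a a8; case: eqP => // ?; lia.
- move=> i s1 ltid [[hi hp hc] hX1 hX hor] fr; split.
    by rewrite hi (fr r_d) //= hd.
  have es1 : env d k A t (nr s1) by apply: env_frame fr _ => //; env_solve es.
  have f1 := es1 r_one isT; have f0 := es1 r_zero isT; have fe := es1 r_e isT.
  rewrite /= -/e in f1 f0 fe.
  have Mii : xr s1 (am + (i * e + i))%N = M (lshift 1 (Ordinal ltid)) (lshift 1 (Ordinal ltid)).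
    by rewrite mxE hX //; lia.
  have ltie : (i < e)%N by rewrite /e; lia.
  do 2!step; rewrite hp hi -addnA Mii; apply: wp_seq.
  set Q := (Q in wp F _ Q).
  have skip : (M (lshift 1 (Ordinal ltid)) (lshift 1 (Ordinal ltid)) != 0 ->
      (nr s1 r_cnt <= nr s1 r_max)%N) ->
      forall x y, Q (Memory (fun j => if j == 20%N then x else nr s1 j)
        (upd (upd (xr s1) 0%N y) 0%N 0)).
    move=> no x y; rewrite /Q.
    do 2!step; rewrite f1 fe hi hp addn1 -addnA -mulSnr; split=> //.
      by move=> a a8 na; do ?[case: eqP => ?; first lia]; exact: hX.
    case: hor => [[ha hb hc']|[ha hb [i' [hc' hd']]]].
      left; split=> //.
        by move=> a a8; do ?[case: eqP => ?; first lia]; exact: hb.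
      move=> i'; rewrite ltnS leq_eqVlt => /orP[/eqP ii|]; last exact: hc'.
      have -> : i' = Ordinal ltid by apply: val_inj.
      by move=> /no; rewrite hc ha.
    right; split=> //; exists i'; split=> // l.
    by do ?[case: eqP => ?; first lia]; exact: hd'.
  apply: wp_ifX => /= Mz.
    apply: wp_base; [reflexivity | apply: skip].
    by rewrite Mz hX1 eqxx.
  rewrite hX1 in Mz.
  apply: wp_ifN => /= lt; last first.
    apply: wp_base; [reflexivity | apply: skip => _]; lia.
  apply: wp_seq; apply: wp_mono (@copy_rowP R F d k A t _ (am + i * e)%N _ A8 eF _ _) _ => //=.
  + by env_solve es1.
  + by rewrite -/e -[(A + k * e)%N]/ab; lia.
  move=> s2; rewrite -/e -[(A + k * e)%N]/ab => -[gX gW] fr2.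
  pull fr2 r_zero e0; pull fr2 r_one e1; pull fr2 r_cnt ec; pull fr2 r_p ep.
  pull fr2 r_e ee; pull fr2 r_i ei.
  do 1!step; rewrite /Q; do 2!step.
  rewrite ei ep e1 e0 ec ee f0 f1 hi hp fe addn1 -addnA -mulSnr addn0.
  (* An earlier copy has raised [r_max] to [r_cnt], so the strict test admits at most one copy per
     scan. *)
  case: hor => [[ha hb hc']|[ha hb _]]; last by move: lt; rewrite hb hc ltnn.
  split=> //.
  * by rewrite gX //; lia.
  * move=> a a8 na; rewrite gX //; last lia.
    by case: eqP => ?; [lia | exact: hX].
  right; split=> //; first by rewrite -ha -hc.
  exists (Ordinal ltid); split; first exact/eqP.
  move=> l; rewrite gW //; case: eqP => ?; first lia.
  by rewrite mxE hX -?addnA //; lia.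
- move=> s' [[hi hp hc] hX1 hX hor] fr; split; first by rewrite hi (fr r_d) //= hd ltnn.
  split=> //; case: hor => [[ha hb hc']|]; [left | by right].
  by split=> // i; apply: hc'.
Qed.

(** * Enumerating the subsets of all blocks *)

Definition homog (R : realType) d (p : 'rV[R]_d) : 'cV[R]_(d + 1) :=
  col_mx p^T (const_mx (-1)).

Definition pts_ok (R : realType) d k (P : 'I_k -> 'rV[R]_d) (A : nat) (X : nat -> R) : Prop :=
  forall i : 'I_k, vecof X (A + i * (d + 1)) (d + 1) = homog (P i).

(** The last block may run past [k]; the digits for its missing points are ignored. *)
Definition chosen (k T B m j : nat) : {set 'I_k} :=
  [set i : 'I_k | (B <= i < B + j)%N && bit T m (i - B)].

Lemma chosen0 k T B m : chosen k T B m 0 = set0.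
Proof. by apply/setP => i; rewrite !inE addn0; case: leqP => // ?; rewrite ltnNge. Qed.

Lemma chosenS_in k T B m j (lt : (B + j < k)%N) : bit T m j ->
  chosen k T B m j.+1 = Ordinal lt |: chosen k T B m j /\ Ordinal lt \notin chosen k T B m j.
Proof.
move=> bj; split; last by rewrite inE /= ltnn andbF.
apply/setP => i; rewrite !inE -val_eqE /=.
case: (eqVneq (val i) (B + j)%N) => [->|ne] /=; first by rewrite addKn bj; lia.
by congr (_ && _); move: ne; rewrite /=; lia.
Qed.

Lemma chosenS_out k T B m j : ~~ ((B + j < k)%N && bit T m j) ->
  chosen k T B m j.+1 = chosen k T B m j.
Proof.
move=> no; apply/setP => i; rewrite !inE.
case: (eqVneq (val i) (B + j)%N) => [ei|ne].
  have := ltn_ord i; move: no; rewrite /= in ei; rewrite ei => /[swap] -> /= /negPf b.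
  by rewrite addKn b !andbF.
by congr (_ && _); move: ne; rewrite /=; lia.
Qed.

(** * The projector of a chosen subset *)

Definition homogs (R : realType) d k (P : 'I_k -> 'rV[R]_d) (S : {set 'I_k}) (v : 'cV[R]_(d + 1)) : Prop :=
  exists2 i, i \in S & v = homog (P i).

(** [r_v] advances over all [t] positions of the block, chosen or not, so that it ends at the start
    of the next block and [search] needs no multiplication of naturals. *)
Definition add_pts : cmd :=
  mov r_r r_m ;; NSet r_cnt 0 ;; NSet r_j 0 ;; mov r_v r_grp ;;
  While r_j r_t (
    NAdd r_r r_r r_r ;;
    IfN r_r r_T (XZero 0) (
      NSub r_r r_r r_T ;; NAdd r_tmp r_B r_j ;;
      IfN r_tmp r_k (incr r_cnt ;; (proj_w ;; proj_upd)) (XZero 0)) ;;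
    NAdd r_v r_v r_e ;; incr r_j).

Lemma add_ptsP (R : realType) F d k A t (P : 'I_k -> 'rV[R]_d) (s : memory R) B m :
  env d k A t (nr s) -> (8 <= A)%N -> (d + 1 <= F)%N -> (t <= F)%N ->
  let aw := nth 0%N (regs d k A t) r_w in
  let am := nth 0%N (regs d k A t) r_mat in
  nr s r_B = B -> nr s r_m = m -> nr s r_grp = (A + B * (d + 1))%N ->
  pts_ok P A (xr s) -> matof (xr s) am (d + 1) = 1%:M ->
  wp F add_pts (fun s' =>
    [/\ forall a, (8 <= a < aw)%N -> xr s' a = xr s a,
      nr s' r_cnt = #|chosen k (2 ^ t) B m t|, nr s' r_v = (A + (B + t) * (d + 1))%N &
      projector (matof (xr s') am (d + 1)) (homogs P (chosen k (2 ^ t) B m t))]) s.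
Proof.
move=> es A8 eF tF aw am hB hmm hg hP hM.
have [aw8 wm] : (A + k * (d + 1) + (d + 1) = aw /\ aw + (d + 1) = am)%N by [].
have h0 := es r_zero isT; rewrite /= in h0.
do 4!step; rewrite ?h0 ?hmm ?hg ?addn0.
pose e := (d + 1)%N; pose ch := chosen k (2 ^ t) B m.
apply: (@wp_while _ _ _ _ _ t (fun j s' =>
  [/\ [/\ nr s' r_j = j, nr s' r_r = iter j (dbl (2 ^ t)) m & nr s' r_v = A + (B + j) * e]%N,
    nr s' r_cnt = #|ch j|,
    forall a, (8 <= a < aw)%N -> xr s' a = xr s a &
    projector (matof (xr s') am e) (homogs P (ch j))])) => //=.
- rewrite addn0 /ch chosen0 cards0; split=> //.
  rewrite /e hM; apply: projector_iff (projector1 R _) => v.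
  by split=> // -[i]; rewrite inE.
- move=> j s1 ltjt [[hj hr hv] hc hX hpr] fr; split.
    by rewrite hj (fr r_t) //= (es r_t).
  have es1 : env d k A t (nr s1) by apply: env_frame fr _ => //; env_solve es.
  have f1 := es1 r_one isT; have fe := es1 r_e isT; have fk := es1 r_k isT.
  have fT := es1 r_T isT; have f0 := es1 r_zero isT; have fw := es1 r_w isT.
  have fm := es1 r_mat isT.
  pull fr r_B fB; rewrite hB in fB; rewrite /= -/e in f1 fe fk fT f0 fw fm.
  rewrite [RHS](_ : _ = aw) // in fw; rewrite [RHS](_ : _ = am) // in fm.
  do 1!step; rewrite hr.
  pose x := iter j (dbl (2 ^ t)) m; rewrite -/x.
  have bitE : bit (2 ^ t) m j = ~~ (x + x < 2 ^ t)%N by rewrite /bit -/x -addnn -leqNgt.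
  have iterE : iter j.+1 (dbl (2 ^ t)) m = dbl (2 ^ t) x by [].
  apply: wp_seq; set Q := (Q in wp F _ Q).
  have fin (s2 : memory R) : env d k A t (nr s2) -> nr s2 r_j = j ->
      nr s2 r_r = dbl (2 ^ t) x -> nr s2 r_v = (A + (B + j) * e)%N ->
      nr s2 r_cnt = #|ch j.+1| ->
      (forall a, (8 <= a < aw)%N -> xr s2 a = xr s a) ->
      projector (matof (xr s2) am e) (homogs P (ch j.+1)) -> Q s2.
    move=> es2 gj gr gv gc gX gP; have g1 := es2 r_one isT; have ge := es2 r_e isT.
    rewrite /Q; do 2!step; rewrite gj gr gv ge g1 addn1 addnS mulSnr addnA.
    by split.
  have skip (s2 : memory R) y : env d k A t (nr s2) -> nr s2 r_j = j ->
      nr s2 r_r = dbl (2 ^ t) x -> nr s2 r_v = (A + (B + j) * e)%N ->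
      nr s2 r_cnt = #|ch j| -> xr s2 = upd (xr s1) 0%N y ->
      ~~ ((B + j < k)%N && bit (2 ^ t) m j) -> Q s2.
    move=> es2 gj gr gv gc gX no.
    have chE : ch j.+1 = ch j by exact: chosenS_out.
    apply: fin => //; rewrite ?chE //.
      by move=> a a8; rewrite gX /upd; case: eqP => ?; [lia | exact: hX].
    rewrite (_ : matof _ _ _ = matof (xr s1) am e) //.
    by apply/matrixP => i l; rewrite !mxE gX /upd; case: eqP => // ?; lia.
  apply: wp_ifN => /=; rewrite fT => lt.
    apply: wp_base; [reflexivity | apply: skip => //=].
    + by env_solve es1.
    + by rewrite /dbl lt.
    + by rewrite bitE lt andbF.
  have dblE : (x + x - 2 ^ t)%N = dbl (2 ^ t) x by rewrite /dbl (negPf lt).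
  do 2!step; rewrite fT fB hj dblE.
  apply: wp_ifN => /=; rewrite fk => ltk; last first.
    apply: wp_base; [reflexivity | apply: skip => //=].
    + by env_solve es1.
    + by rewrite (negPf ltk).
  rewrite -bitE in lt; have [chE chN] := chosenS_in ltk lt.
  have ptle : ((B + j) * e + e <= k * e)%N by rewrite -mulSnr leq_mul2r ltk orbT.
  rewrite -/e in aw8 wm.
  do 1!step; rewrite f1 hc addn1.
  apply: wp_mono (@projP R F e aw am (A + (B + j) * e) _ _ _ _ _ _ _ _ _ _ _) _ => //=.
  + by lia.
  + by lia.
  move=> s2 [gX gM] fr2.
  pull fr2 r_j ej; pull fr2 r_r er; pull fr2 r_v ev; pull fr2 r_cnt ec.
  apply: fin; rewrite ?ej ?er ?ev ?ec //.
  + by apply: env_frame fr2 _ => //; env_solve es1.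
  + by rewrite /ch chE cardsU1 chN add1n.
  + by move=> a a8; rewrite gX ?hX.
  rewrite gM; apply: proj_stepP hpr _ => u; rewrite /homogs /ch chE.
  have -> : vecof (xr s1) (A + (B + j) * e) e = homog (P (Ordinal ltk)).
    rewrite -[RHS]hP; apply/colP => l; rewrite !mxE /= hX //.
    by have := ltn_ord l; lia.
  split=> [[i]|[[i iS ->]|->]].
  + by rewrite !inE => /orP[/eqP->|iS] ->; [right | left; exists i; rewrite ?inE].
  + by exists i => //; rewrite inE iS orbT.
  + by exists (Ordinal ltk) => //; rewrite setU11.
- move=> s' [[hj hr hv] hc hX hpr] fr; split=> //.
  by rewrite hj (fr r_t) //= (es r_t) //= ltnn.
Qed.

(** * Hyperplanes read off a projector *)

Lemma dot_homog (R : realType) d (p a : 'rV[R]_d) (b : R) :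
  dot (homog p) (col_mx a^T (const_mx b)) = (p *m a^T) 0 0 - b.
Proof.
rewrite /dot /homog tr_col_mx mul_row_col trmxK mxE; congr (_ + _).
by rewrite mxE big_ord1 !mxE mulN1r.
Qed.

Definition stored_a (R : realType) d (X : nat -> R) (ab : nat) : 'rV[R]_d :=
  \row_l X (ab + l)%N.

(** Inclusion instead of equality: an enumerated set is only the part of a hyperplane inside one
    block. *)
Definition coverable (R : realType) d k (P : 'I_k -> 'rV[R]_d) (S : {set 'I_k}) : Prop :=
  exists a b, a != 0 /\ S \subset on_hp a b P.

(** Only a lower bound is tracked, as the stored hyperplane may pass through further points. *)
Definition stored_ok (R : realType) d k (P : 'I_k -> 'rV[R]_d) (ab n : nat) (X : nat -> R) : Prop :=
  stored_a d X ab != 0 /\ (n <= #|on_hp (stored_a d X ab) (X (ab + d)%N) P|)%N.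

(** The vector [(a, b)] of a covering hyperplane is orthogonal to all chosen points, hence fixed by
    [M]; a nonzero coordinate of [a] then forces a nonzero diagonal entry at an index below [d]. *)
Lemma projector_coverable (R : realType) d k (P : 'I_k -> 'rV[R]_d) S (M : 'M[R]_(d + 1)) :
  projector M (homogs P S) -> coverable P S ->
  exists i : 'I_d, M (lshift 1 i) (lshift 1 i) != 0.
Proof.
move=> pM [a [b [a0 /subsetP Sab]]].
have /rV0Pn [i ai] := a0; exists i.
apply: (projector_diag (u := col_mx a^T (const_mx b)) pM); last by rewrite col_mxEu mxE.
move=> _ [i' /Sab + ->]; rewrite inE dot_homog => /eqP ->; exact: subrr.
Qed.

(** [M] kills the chosen points, so each of its rows is orthogonal to them. The diagonal entry is
    itself a coordinate of the normal part of row [i], which is therefore nonzero. *)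
Lemma projector_stored (R : realType) d k (P : 'I_k -> 'rV[R]_d) S (M : 'M[R]_(d + 1))
    (X : nat -> R) ab (i : 'I_d) :
  projector M (homogs P S) -> M (lshift 1 i) (lshift 1 i) != 0 ->
  (forall l : 'I_(d + 1), X (ab + l)%N = M (lshift 1 i) l) ->
  stored_ok P ab #|S| X.
Proof.
move=> pM Mi XM; split.
  by apply/rV0Pn; exists i; rewrite mxE; have := XM (lshift 1 i) => /= ->.
apply/subset_leq_card/subsetP => j jS; rewrite inE -subr_eq0 -dot_homog; apply/eqP.
have := projector_row (lshift 1 i) pM (ex_intro2 _ _ j jS erefl) => <-.
rewrite dot_sum; apply: eq_bigr => l _; rewrite mulrC; congr (_ * _).
rewrite -XM; case: (split_ordP l) => [l' ->|l' ->]; rewrite ?col_mxEu ?col_mxEd !mxE //.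
by rewrite ord1 /= addn0.
Qed.

Definition try_subset : cmd := init_mat ;; add_pts ;; scan.

Lemma try_subsetP (R : realType) F d k A t (P : 'I_k -> 'rV[R]_d) (s : memory R) B m :
  env d k A t (nr s) -> (8 <= A)%N -> (d + 1 <= F)%N -> (t <= F)%N ->
  let ab := nth 0%N (regs d k A t) r_best in
  nr s r_B = B -> nr s r_m = m -> nr s r_grp = (A + B * (d + 1))%N ->
  pts_ok P A (xr s) -> stored_ok P ab (nr s r_max) (xr s) ->
  wp F try_subset (fun s' =>
    [/\ pts_ok P A (xr s'), stored_ok P ab (nr s' r_max) (xr s'),
      (nr s r_max <= nr s' r_max)%N, nr s' r_v = (A + (B + t) * (d + 1))%N &
      coverable P (chosen k (2 ^ t) B m t) ->
        (#|chosen k (2 ^ t) B m t| <= nr s' r_max)%N]) s.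
Proof.
move=> es A8 eF tF ab hB hm hg hP hS.
have pts_eq (X X' : nat -> R) : (forall a, (8 <= a < ab)%N -> X' a = X a) ->
    pts_ok P A X -> pts_ok P A X'.
  move=> XX hX i; rewrite -hX; apply/colP => l; rewrite !mxE; apply: XX.
  have : (i * (d + 1) + (d + 1) <= k * (d + 1))%N by rewrite -mulSnr leq_mul2r ltn_ord orbT.
  by have := ltn_ord l; rewrite /ab /=; lia.
have stored_eq (X X' : nat -> R) n : (forall a, (ab <= a < ab + (d + 1))%N -> X' a = X a) ->
    stored_ok P ab n X -> stored_ok P ab n X'.
  move=> XX; rewrite /stored_ok (_ : stored_a d X' ab = stored_a d X ab).
    by rewrite XX //; lia.
  by apply/rowP => l; rewrite !mxE; apply: XX; have := ltn_ord l; lia.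
have ab8 : (8 <= ab)%N by rewrite /ab /=; lia.
apply: wp_seq; apply: wp_mono (init_matP es A8 eF) _ => s1 [X1 M1] fr1.
have es1 := env_frame es fr1 isT.
have mE : nth 0%N (regs d k A t) r_mat = (ab + (d + 1) + (d + 1))%N by [].
have wE : nth 0%N (regs d k A t) r_w = (ab + (d + 1))%N by [].
rewrite mE in X1 M1.
have hP1 : pts_ok P A (xr s1) by apply: pts_eq hP => a a8; apply: X1; lia.
have hS1 : stored_ok P ab (nr s r_max) (xr s1).
  by apply: stored_eq hS => a a8; apply: X1; lia.
have B1 : nr s1 r_B = B by rewrite fr1.
have m1 : nr s1 r_m = m by rewrite fr1.
have g1 : nr s1 r_grp = (A + B * (d + 1))%N by rewrite fr1.
apply: wp_seq; apply: wp_mono (add_ptsP es1 A8 eF tF B1 m1 g1 hP1 M1) _.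
move=> s2 [X2 c2 v2 pr2] fr2; rewrite mE wE in X2 pr2.
have es2 := env_frame es1 fr2 isT.
have hP2 : pts_ok P A (xr s2) by apply: pts_eq hP1 => a a8; apply: X2; lia.
have max2 : nr s2 r_max = nr s r_max by rewrite fr2 // fr1.
have hS2 : stored_ok P ab (nr s2 r_max) (xr s2).
  by rewrite max2; apply: stored_eq hS1 => a a8; apply: X2; lia.
apply: wp_mono (scanP es2 A8 eF) _ => s3 [X3 or3] fr3; rewrite mE -/ab in X3 or3.
rewrite (fr3 r_v) // v2 -max2; set S := chosen _ _ _ _ _ in c2 pr2 *.
have hP3 : pts_ok P A (xr s3) by apply: pts_eq hP2 => a a8; apply: X3; lia.
case: or3 => [[mx3 XX3 none]|[lt3 mx3 [i [Mi Xi]]]].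
  rewrite mx3; split=> //.
    by apply: stored_eq hS2 => a a8; apply: XX3; lia.
  by move=> cov; have [i /none] := projector_coverable pr2 cov; rewrite c2.
rewrite mx3 c2 in lt3 *; split=> //; last exact: ltnW.
exact: projector_stored pr2 Mi Xi.
Qed.

Definition search : cmd :=
  NSet r_B 0 ;; mov r_grp r_pts ;;
  While r_B r_k (
    NSet r_m 0 ;;
    While r_m r_T (try_subset ;; incr r_m) ;;
    mov r_grp r_v ;; NAdd r_B r_B r_t).

Lemma searchP (R : realType) F d k A t (P : 'I_k -> 'rV[R]_d) (s : memory R) :
  env d k A t (nr s) -> (8 <= A)%N -> (d + 1 <= F)%N -> (t <= F)%N ->
  (2 ^ t <= F)%N -> (k <= F)%N -> (0 < t)%N ->
  let ab := nth 0%N (regs d k A t) r_best in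
  pts_ok P A (xr s) -> stored_ok P ab (nr s r_max) (xr s) ->
  wp F search (fun s' => exists2 n, stored_ok P ab n (xr s') &
      forall g m, (g * t < k)%N -> (m < 2 ^ t)%N ->
        coverable P (chosen k (2 ^ t) (g * t) m t) ->
        (#|chosen k (2 ^ t) (g * t) m t| <= n)%N) s.
Proof.
move=> es A8 eF tF TF kF t0 ab hP hS.
have h0 := es r_zero isT; have hA := es r_pts isT; rewrite /= in h0 hA.
do 2!step; rewrite h0 hA addn0.
(* The number of blocks: [k / t] rounded up. *)
pose W := ((k + t - 1) %/ t)%N.
have Wlt g : (g < W)%N -> (g * t < k)%N.
  by rewrite /W leq_divRL // mulSn; lia.
have Wge : (k <= W * t)%N.
  by have := divn_eq (k + t - 1) t; have := ltn_pmod (k + t - 1) t0; rewrite -/W; lia.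
have WF : (W <= F)%N.
  have [->//|W0] := posnP W.
  have := Wlt W.-1; rewrite prednK // => /(_ (leqnn _)); nia.
pose seen g0 n := forall g m, (g < g0)%N -> (m < 2 ^ t)%N ->
  coverable P (chosen k (2 ^ t) (g * t) m t) ->
  (#|chosen k (2 ^ t) (g * t) m t| <= n)%N.
apply: (@wp_while _ _ _ _ _ W (fun g s' =>
  [/\ nr s' r_B = (g * t)%N, nr s' r_grp = (A + g * t * (d + 1))%N,
    pts_ok P A (xr s'), stored_ok P ab (nr s' r_max) (xr s') & seen g (nr s' r_max)])) => //=.
- by rewrite addn0.
- move=> g s1 ltg [hB hg hP1 hS1 sn1] fr; split.
    by rewrite hB (fr r_k) //= (es r_k) //; exact: Wlt.
  have es1 : env d k A t (nr s1) by apply: env_frame fr _ => //; env_solve es.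
  do 1!step; apply: wp_seq.
  (* [r_v] is meaningful only after a subset has been tried, hence the guard [0 < m]; at the end
     [2 ^ t] is positive. *)
  apply: (@wp_while _ _ _ _ _ (2 ^ t) (fun m s' =>
    [/\ nr s' r_m = m, pts_ok P A (xr s'), stored_ok P ab (nr s' r_max) (xr s'),
      (nr s1 r_max <= nr s' r_max)%N /\
      ((0 < m)%N -> nr s' r_v = (A + (g * t + t) * (d + 1))%N) &
      forall m', (m' < m)%N -> coverable P (chosen k (2 ^ t) (g * t) m' t) ->
        (#|chosen k (2 ^ t) (g * t) m' t| <= nr s' r_max)%N])) => //=.
  + move=> m s2 ltm [hm hP2 hS2 [le2 _] sn2] fr2.
    have es2 : env d k A t (nr s2) by apply: env_frame fr2 _ => //; env_solve es1.
    split; first by rewrite hm (es2 r_T).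
    pull fr2 r_B eB; pull fr2 r_grp eg; rewrite hB in eB; rewrite hg in eg.
    apply: wp_seq; apply: wp_mono (try_subsetP es2 A8 eF tF eB hm eg hP2 hS2) _.
    move=> s3 [hP3 hS3 le3 hv3 sn3] fr3; pull fr3 r_m em; pull fr3 r_one e1.
    do 1!step; rewrite em e1 hm (es2 r_one) //= addn1; split=> //.
      by split=> //; exact: leq_trans le3.
    move=> m'; rewrite ltnS leq_eqVlt => /orP[/eqP ->//|lt] cov.
    by apply: leq_trans le3; exact: sn2.
  + move=> s2 [hm hP2 hS2 [le2 hv] sn2] fr2.
    have es2 : env d k A t (nr s2) by apply: env_frame fr2 _ => //; env_solve es1.
    split; first by rewrite hm (es2 r_T) //= ltnn.
    pull fr2 r_B eB; rewrite hB in eB.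
    do 2!step; rewrite eB (es2 r_t) //= (es2 r_zero) //= hv ?expn_gt0 // addn0 mulSnr; split=> //.
    move=> g' m'; rewrite ltnS leq_eqVlt => /orP[/eqP ->|lt] ltm' cov; first exact: sn2.
    by apply: leq_trans le2; exact: sn1.
- move=> s' [hB hg hP1 hS1 sn1] fr; split.
    by rewrite hB (fr r_k) //= (es r_k) //= -leqNgt.
  exists (nr s' r_max) => // g m gt; apply: sn1.
  by rewrite -(ltn_pmul2r t0); exact: leq_trans Wge.
Qed.

(** * Preparing the input and writing the output *)

(** Beyond the scratch words and the input. The last [d] ensures [d < base_addr d k] even for
    [k = 0], so that [finish], which writes words [0] to [d], cannot overwrite the hyperplane it
    reads. *)
Definition base_addr (d k : nat) : nat := (8 + k * d + d)%N.

Definition setup_regs : cmd :=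
  NSet r_one 1 ;; NAdd r_e r_d r_one ;; NSet r_pts 8 ;; NSet r_i 0 ;;
  While r_i r_k (NAdd r_pts r_pts r_d ;; incr r_i) ;;
  NAdd r_pts r_pts r_d.

Lemma setup_regsP (R : realType) F d k (s : memory R) :
  nr s r_d = d -> nr s r_k = k -> (k <= F)%N ->
  wp F setup_regs (fun s' => [/\ nr s' r_one = 1, nr s' r_e = d + 1,
    nr s' r_pts = base_addr d k & xr s' = xr s]%N) s.
Proof.
move=> hd hk kF; do 4!step; rewrite hd; apply: wp_seq.
apply: (@wp_while _ _ _ _ _ k (fun i s' =>
  [/\ nr s' r_i = i, nr s' r_pts = 8 + i * d & xr s' = xr s]%N)) => //=.
- move=> i s1 ltk [hi hp hX] fr; pull fr r_one f1; pull fr r_d f0; pull fr r_k fk.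
  split; first by rewrite hi fk hk.
  by do 2!step; rewrite hi hp f1 f0 hd addn1 mulSnr addnA.
- move=> s1 [hi hp hX] fr; pull fr r_one f1; pull fr r_d f0; pull fr r_k fk; pull fr r_e fe.
  split; first by rewrite hi fk hk ltnn.
  by step; rewrite hp f1 f0 fe hd.
Qed.

(* The running input word is always held in register [0], the only word that
   has to be clobbered before the input has been moved away. *)
Definition setup_copy : cmd :=
  mov r_q r_pts ;; NSet r_p 0 ;; NSet r_i 0 ;;
  While r_i r_k (
    NSet r_l 0 ;;
    While r_l r_d (
      XStore r_q 0 ;; incr r_p ;; incr r_q ;; XLoad 0 r_p ;; incr r_l) ;;
    incr r_q ;; incr r_i).

Lemma setup_copyP (R : realType) F d k A (s : memory R) :
  nr s r_d = d -> nr s r_k = k -> nr s r_one = 1%N -> nr s r_zero = 0%N ->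
  nr s r_pts = A -> (8 + k * d <= A)%N -> (k <= F)%N -> (d <= F)%N ->
  wp F setup_copy (fun s' => nr s' r_q = (A + k * (d + 1))%N /\
    forall i l, (i < k)%N -> (l < d)%N ->
      xr s' (A + (i * (d + 1) + l))%N = xr s (i * d + l)%N) s.
Proof.
move=> hd hk h1 h0 hA A8 kF dF; pose e := (d + 1)%N; rewrite -/e.
(* [W] undoes the change of stride from [d] to [e]; the word at remainder [d] is left for the
   coordinate [-1]. *)
pose W z := xr s (z %/ e * d + z %% e)%N.
have We i l : (l < e)%N -> W (i * e + l)%N = xr s (i * d + l)%N.
  by move=> lte; rewrite /W divnMDl ?modnMDl ?divn_small ?modn_small ?addn0 //; lia.
do 3!step; rewrite hA h0 addn0.
apply: (@wp_while _ _ _ _ _ k (fun i s' =>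
  [/\ [/\ nr s' r_i = i, nr s' r_p = i * d & nr s' r_q = A + i * e]%N,
    xr s' 0%N = xr s (i * d)%N,
    forall a, (0 < a < A)%N -> xr s' a = xr s a &
    forall z, (z < i * e)%N -> (z %% e < d)%N -> xr s' (A + z)%N = W z])) => //=.
- by rewrite !mul0n addn0.
- move=> i s1 ltik [[hi hp hq] hX0 hX hW] fr.
  pull fr r_one f1; pull fr r_d fd; pull fr r_k fk; rewrite ?h1 ?hd ?hk in f1 fd fk.
  have idk : (i * d + d <= k * d)%N by rewrite -mulSnr leq_mul2r ltik orbT.
  split; first by rewrite hi fk.
  do 1!step; apply: wp_seq.
  apply: (@wp_while _ _ _ _ _ d (fun l s' =>
    [/\ [/\ nr s' r_l = l, nr s' r_p = i * d + l & nr s' r_q = A + (i * e + l)]%N,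
      xr s' 0%N = xr s (i * d + l)%N,
      forall a, (0 < a < A)%N -> xr s' a = xr s a &
      forall z, (z < i * e + l)%N -> (z %% e < d)%N -> xr s' (A + z)%N = W z])) => //=.
  + by rewrite !addn0.
  + move=> l s2 ltld [[gl gp gq] gX0 gX gW] fr2; pull fr2 r_one e1; pull fr2 r_d ed.
    rewrite f1 in e1; rewrite fd in ed; split; first by rewrite gl ed.
    do 5!step; rewrite gl gp gq e1 !addn1 -!addnS; split=> //.
    * by case: eqP => ?; [lia | apply: gX; lia].
    * by move=> a a0; do ?[case: eqP => ?; first lia]; exact: gX.
    * move=> z; rewrite eqn_add2l addnS ltnS (leq_eqVlt z).
      case: (eqVneq z (i * e + l)%N) => [->|nz] /=; rewrite ifF; try lia.
        by rewrite We // /e; lia.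
      exact: gW.
  + move=> s2 [[gl gp gq] gX0 gX gW] fr2; pull fr2 r_one e1; pull fr2 r_d ed; pull fr2 r_i ei.
    rewrite f1 in e1; rewrite fd in ed; rewrite hi in ei.
    split; first by rewrite gl ed ltnn.
    do 2!step; rewrite ei gp gq e1 !addn1 !mulSnr -addnS; split=> //.
      by rewrite -!addnS /e addn1.
    move=> z ltz mz; apply: gW => //; case: (eqVneq z (i * e + d)%N) => [zE|nz].
      by move: mz; rewrite zE modnMDl modn_small /e; lia.
    by rewrite /e in ltz nz *; lia.
- move=> s1 [[hi hp hq] hX0 hX hW] fr; split; first by rewrite hi (fr r_k) //= hk ltnn.
  split=> // i l ltik ltld; have ike : (i * e + e <= k * e)%N by rewrite -mulSnr leq_mul2r ltik orbT.
  by rewrite hW ?modnMDl ?modn_small ?We //; rewrite /e in ike *; lia.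
Qed.

(** The [1] stored at [r_best] makes the initial normal nonzero, so the output is a hyperplane even
    if the search never replaces it. *)
Definition setup_homog : cmd :=
  mov r_best r_q ;; XZero 1 ;; XOne 0 ;; XSub 2 1 0 ;; NAdd r_p r_pts r_d ;; NSet r_i 0 ;;
  While r_i r_k (XStore r_p 2 ;; NAdd r_p r_p r_e ;; incr r_i) ;;
  XStore r_best 0 ;; NAdd r_w r_best r_e ;; NAdd r_mat r_w r_e.

Lemma setup_homogP (R : realType) F d k A (s : memory R) :
  nr s r_d = d -> nr s r_k = k -> nr s r_one = 1%N -> nr s r_zero = 0%N ->
  nr s r_e = (d + 1)%N ->
  let ab := (A + k * (d + 1))%N in
  nr s r_pts = A -> (8 <= A)%N -> (k <= F)%N -> nr s r_q = ab ->
  wp F setup_homog (fun s' =>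
    [/\ [/\ nr s' r_best = ab, nr s' r_w = ab + (d + 1) & nr s' r_mat = ab + (d + 1) + (d + 1)]%N,
    xr s' ab = 1,
    forall i l, (i < k)%N -> (l < d)%N ->
      xr s' (A + (i * (d + 1) + l))%N = xr s (A + (i * (d + 1) + l))%N &
    forall i, (i < k)%N -> xr s' (A + (i * (d + 1) + d))%N = -1]) s.
Proof.
move=> hd hk h1 h0 he ab hA A8 kF hq; pose e := (d + 1)%N; rewrite -/e in he *.
do 6!step; rewrite hA h0 hd hq addn0; apply: wp_seq.
apply: (@wp_while _ _ _ _ _ k (fun i s' =>
  [/\ [/\ nr s' r_i = i & nr s' r_p = A + (i * e + d)]%N,
    xr s' 0%N = 1 /\ xr s' 2%N = -1,
    forall z, (z %% e < d)%N -> xr s' (A + z)%N = xr s (A + z)%N &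
    forall i', (i' < i)%N -> xr s' (A + (i' * e + d))%N = -1])) => //=.
- split=> //; first by rewrite sub0r.
  by move=> z _; do ?[case: eqP => ?; first lia].
- move=> i s1 ltik [[hi hp] [hX0 hX2] hX hW] fr; split.
    by rewrite hi (fr r_k) //= hk.
  pull fr r_one f1; pull fr r_e fe; rewrite h1 in f1; rewrite he in fe.
  do 3!step; rewrite hi hp f1 fe addn1; split=> //.
  + by split=> //; rewrite mulSnr; lia.
  + by do ?[case: eqP => ?; first lia].
  + move=> z mz; rewrite eqn_add2l; case: eqP => [zE|_]; last exact: hX.
    by move: mz; rewrite zE modnMDl modn_small /e; lia.
  + move=> i'; rewrite ltnS => le; case: eqP => // ne; apply: hW.
    by rewrite ltn_neqAle le andbT; apply/eqP => ii; apply: ne; rewrite ii.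
- move=> s1 [[hi hp] [hX0 hX2] hX hW] fr; split.
    by rewrite hi (fr r_k) //= hk ltnn.
  pull fr r_best fb; pull fr r_e fe; rewrite he in fe.
  do 3!step; rewrite fb fe eqxx hX0; split=> // [i l ltik ltld|i ltik].
    have ike : (i * e + e <= k * e)%N by rewrite -mulSnr leq_mul2r ltik orbT.
    case: eqP => [|_]; first by rewrite /ab /e in ike *; lia.
    by rewrite hX // modnMDl modn_small /e; lia.
  have ike : (i * e + e <= k * e)%N by rewrite -mulSnr leq_mul2r ltik orbT.
  case: eqP => [|_]; first by rewrite /ab /e in ike *; lia.
  exact: hW.
Qed.

(** [up_log] is [0] for [k <= 1]; the maximum keeps blocks nonempty, so that the search advances. *)
Definition block_size (k : nat) : nat := maxn 1 (up_log 2 k).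

Lemma block_size_ge k : (k <= 2 ^ block_size k)%N.
Proof.
rewrite /block_size; case: (ltnP 1 k) => lt.
  have /andP[_ le] := up_log_bounds (isT : 1 < 2)%N lt.
  by apply: leq_trans le _; rewrite leq_exp2l // leq_maxr.
by case: k lt => [|[|]].
Qed.

Lemma block_size_lt k t : (0 < t)%N -> (t < block_size k)%N -> (2 ^ t < k)%N.
Proof.
rewrite /block_size => t0; case: (ltnP 1 k) => lt.
  have /andP[le _] := up_log_bounds (isT : 1 < 2)%N lt.
  rewrite leq_max => /orP[|ltt]; first lia.
  by apply: leq_ltn_trans le; rewrite leq_exp2l //; lia.
case: k lt => [|[|//]] _; first by rewrite up_log0; lia.
by rewrite up_log1; lia.
Qed.

Lemma block_size_le k : (0 < k)%N -> (block_size k <= k)%N.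
Proof.
move=> k0; case E : (block_size k) => [//|[//|t]].
have := @block_size_lt k t.+1 isT; rewrite E => /(_ (leqnn _)) lt.
by apply: leq_ltn_trans lt; rewrite ltnW // ltn_expl.
Qed.

(** This keeps the number of subsets per block linear in [k]; the summand [2] covers [k = 0]. *)
Lemma block_size_exp k : (2 ^ block_size k <= 2 * k + 2)%N.
Proof.
case E : (block_size k) => [|[|t]]; [by rewrite expn0; lia | by rewrite expn1; lia |].
have := @block_size_lt k t.+1 isT; rewrite E => /(_ (leqnn _)).
by rewrite [in X in _ -> X]expnS; lia.
Qed.

Definition setup_block : cmd :=
  NSet r_t 1 ;; NSet r_T 2 ;;
  While r_T r_k (NAdd r_T r_T r_T ;; incr r_t).

Lemma setup_blockP (R : realType) F k (s : memory R) :
  nr s r_k = k -> nr s r_one = 1%N -> (k <= F)%N ->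
  wp F setup_block (fun s' =>
    [/\ nr s' r_t = block_size k, nr s' r_T = (2 ^ block_size k)%N & xr s' = xr s]) s.
Proof.
move=> hk h1 kF; do 2!step.
have b0 : (0 < block_size k)%N by rewrite leq_maxl.
have bF : ((block_size k).-1 <= F)%N.
  have [k0|k0] := posnP k; first by rewrite k0 /block_size up_log0.
  by have := block_size_le k0; lia.
apply: (@wp_while _ _ _ _ _ (block_size k).-1 (fun i s' =>
  [/\ nr s' r_t = i.+1, nr s' r_T = 2 ^ i.+1 & xr s' = xr s]%N)) => //=.
- move=> i s1 lti [ht hT hX] fr; pull fr r_one f1; pull fr r_k fk; split.
    by rewrite hT fk hk; apply: block_size_lt => //; lia.
  by do 2!step; rewrite ht hT f1 h1 addn1 addnn -mul2n -expnS.
- move=> s1 [ht hT hX] fr; pull fr r_k fk; rewrite prednK // in ht hT; split=> //.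
  by rewrite hT fk hk -leqNgt block_size_ge.
Qed.

Definition setup : cmd := setup_regs ;; setup_copy ;; setup_homog ;; setup_block.

Lemma setupP (R : realType) F d k (P : 'I_k -> 'rV[R]_d) (s : memory R) :
  nr s r_d = d -> nr s r_k = k -> (forall r, (1 < r)%N -> nr s r = 0%N) ->
  (forall (i : 'I_k) (l : 'I_d), xr s (i * d + l)%N = P i 0 l) ->
  (0 < d)%N -> (k <= F)%N -> (d <= F)%N ->
  let A := base_addr d k in
  let t := block_size k in
  wp F setup (fun s' =>
    [/\ env d k A t (nr s'), pts_ok P A (xr s') &
      stored_ok P (nth 0%N (regs d k A t) r_best) (nr s' r_max) (xr s')]) s.
Proof.
move=> hd hk h0 hX d0 kF dF A t.
have A8 : (8 + k * d <= A)%N by rewrite /A /base_addr; lia.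
apply: wp_seq; apply: wp_mono (setup_regsP hd hk kF) _ => s1 [h1 he hA X1] fr1.
have d1 : nr s1 r_d = d by rewrite fr1.
have k1 : nr s1 r_k = k by rewrite fr1.
have z1 : nr s1 r_zero = 0%N by rewrite fr1 // h0.
apply: wp_seq; apply: wp_mono (setup_copyP d1 k1 h1 z1 hA A8 kF dF) _.
rewrite X1 => s2 [hq hc] fr2.
have d2 : nr s2 r_d = d by rewrite fr2.
have k2 : nr s2 r_k = k by rewrite fr2.
have o2 : nr s2 r_one = 1%N by rewrite fr2.
have z2 : nr s2 r_zero = 0%N by rewrite fr2.
have e2 : nr s2 r_e = (d + 1)%N by rewrite fr2.
have A2 : nr s2 r_pts = A by rewrite fr2.
have A8' : (8 <= A)%N by lia.
apply: wp_seq; apply: wp_mono (setup_homogP d2 k2 o2 z2 e2 A2 A8' kF hq) _.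
move=> s3 [[hb hw hm] Xb Xp Xh] fr3.
have k3 : nr s3 r_k = k by rewrite fr3.
have o3 : nr s3 r_one = 1%N by rewrite fr3.
apply: wp_mono (setup_blockP k3 o3 kF) _ => s4 [ht hT X4] fr4.
split.
- case=> [|[|[|[|[|[|[|[|[|[|[|//]]]]]]]]]]] _; rewrite ?ht ?hT //;
    rewrite fr4 ?hw ?hb ?hm // fr3 // ?d2 ?k2 ?o2 ?z2 ?e2 ?A2.
- move=> i; apply/colP => l; rewrite mxE X4 /homog.
  case: (split_ordP l) => [l' ->|l' ->]; rewrite ?col_mxEu ?col_mxEd !mxE /=.
    by rewrite -addnA Xp // hc // hX.
  by rewrite ord1 addn0 -addnA Xh.
(* The count in [r_max] is still [0], so only the nonzero normal is at stake; [0 < d] provides its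
   first coordinate. *)
- rewrite fr4 // fr3 // fr2 // fr1 // h0 // X4; split=> //.
  apply/rV0Pn; exists (Ordinal d0); rewrite mxE /= addn0 Xb; exact: oner_neq0.
Qed.

(** Word [0] carries each value being moved, so it receives its own value last. *)
Definition finish : cmd :=
  NSet r_i 1 ;; NAdd r_p r_best r_one ;;
  While r_i r_e (XLoad 0 r_p ;; XStore r_i 0 ;; incr r_p ;; incr r_i) ;;
  XLoad 0 r_best.

Lemma finishP (R : realType) F d k A t (s : memory R) :
  env d k A t (nr s) -> (d < A)%N -> (d <= F)%N ->
  wp F finish (fun s' => forall l, (l <= d)%N ->
    xr s' l = xr s (nth 0%N (regs d k A t) r_best + l)%N) s.
Proof.
move=> es dA dF; set ab := nth _ _ _.
have abd : (d < ab)%N by rewrite /ab /=; lia.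
have h1 := es r_one isT; have he := es r_e isT; have hb := es r_best isT.
rewrite /= in h1 he hb; rewrite -[RHS]/ab in hb.
do 2!step; rewrite hb h1; apply: wp_seq.
apply: (@wp_while _ _ _ _ _ d (fun i s' =>
  [/\ nr s' r_i = i.+1, nr s' r_p = (ab + i.+1)%N,
    forall a, (d < a)%N -> xr s' a = xr s a &
    forall l, (0 < l < i.+1)%N -> xr s' l = xr s (ab + l)%N])) => //=.
- by split=> // l; lia.
- move=> i s1 ltid [hi hp hX hW] fr; split.
    by rewrite hi (fr r_e) //= he; lia.
  pull fr r_one f1; rewrite h1 in f1.
  do 4!step; rewrite hi hp f1 !addn1 -!addnS; split=> // [a ad|l].
    by do ?[case: eqP => ?; first lia]; exact: hX.
  case: (eqVneq l i.+1) => [->|ne] lt; first by rewrite hX //; lia.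
  by case: eqP => ?; [lia | apply: hW; lia].
- move=> s1 [hi hp hX hW] fr; split; first by rewrite hi (fr r_e) //= he; lia.
  pull fr r_best fb; rewrite hb in fb.
  step; rewrite fb => -[|l] ld; first by rewrite eqxx addn0 hX.
  by rewrite /= hW.
Qed.

(** * The approximation ratio *)

(** The trace of the hyperplane on each block is one of the enumerated subsets and is covered by the
    hyperplane itself, so it has at most [n] points; at most [(k %/ t).+1] blocks occur. *)
Lemma hyperplane_blocks (R : realType) d k (P : 'I_k -> 'rV[R]_d) t n (a : 'rV[R]_d) b :
  (0 < t)%N -> a != 0 ->
  (forall g m, (g * t < k)%N -> (m < 2 ^ t)%N ->
    coverable P (chosen k (2 ^ t) (g * t) m t) ->
    (#|chosen k (2 ^ t) (g * t) m t| <= n)%N) ->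
  (#|on_hp a b P| <= (k %/ t).+1 * n)%N.
Proof.
move=> t0 a0 H; set S := on_hp a b P.
have block g : (#|[set i in S | (g * t <= i < g * t + t)%N]| <= n)%N.
  have [lt|ge] := ltnP (g * t) k; last first.
    rewrite (_ : [set _ in _ | _] = set0) ?cards0 //.
    by apply/setP => i; rewrite !inE; have := ltn_ord i; case: (_ == b); lia.
  have [m ltm bm] := bit_surj t (fun j => [exists i in S, val i == (g * t + j)%N]).
  have chE : [set i in S | (g * t <= i < g * t + t)%N] = chosen k (2 ^ t) (g * t) m t.
    apply/setP => i; rewrite [RHS]inE !inE andbC.
    case: (boolP ((g * t <= i < g * t + t)%N)) => //= /andP[le lti].
    rewrite bm; last lia.
    apply/idP/existsP => [iS|[i' /andP[+ /eqP i'E]]].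
      by exists i; rewrite inE iS /=; apply/eqP; lia.
    by rewrite subnKC // in i'E; rewrite (val_inj i'E) inE.
  rewrite chE; apply: H => //; exists a, b; split=> //.
  by rewrite -chE; apply/subsetP => i; rewrite inE => /andP[].
have upto g : (#|[set i in S | (i < g * t)%N]| <= g * n)%N.
  elim: g => [|g IH]; first by rewrite (_ : [set _ in _ | _] = set0) ?cards0 //;
    apply/setP => i; rewrite !inE andbF.
  rewrite [leqRHS]mulSnr; apply: leq_trans (leq_add IH (block g)).
  apply: leq_trans (leq_card_setU _ _); apply/subset_leq_card/subsetP => i.
  by rewrite !inE; case: (_ == b) => //=; rewrite mulSnr; lia.
apply: leq_trans (upto _); apply/subset_leq_card/subsetP => i iS.
rewrite inE iS /=; have := ltn_ord i; have := divn_eq k t; have := ltn_pmod k t0.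
by rewrite mulSnr; lia.
Qed.

(** The factor [2] pays for an incomplete last block: [(k %/ t).+1 * t <= k + t <= 2 * k]. *)
Lemma OPT_blocks (R : realType) d k (P : 'I_k -> 'rV[R]_d) t n :
  (0 < t <= k)%N ->
  (forall g m, (g * t < k)%N -> (m < 2 ^ t)%N ->
    coverable P (chosen k (2 ^ t) (g * t) m t) ->
    (#|chosen k (2 ^ t) (g * t) m t| <= n)%N) ->
  (OPT P * t <= 2 * k * n)%N.
Proof.
move=> /andP[t0 tk] H.
have le : (OPT P <= (k %/ t).+1 * n)%N.
  apply/bigmax_leqP => S /asboolP [a [b [a0 ->]]].
  exact: hyperplane_blocks.
apply: leq_trans (leq_mul le (leqnn t)) _; rewrite mulnAC leq_mul2r.
by rewrite mulSn mul2n -addnn leq_add ?leq_divM ?orbT.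
Qed.

Lemma ln_le_log2 (R : realType) k t : (0 < k)%N -> (k <= 2 ^ t)%N -> ln (k%:R : R) <= t%:R.
Proof.
move=> k0 kt; apply: (@le_trans _ _ (ln ((2 ^ t)%:R))).
  by rewrite ler_ln ?posrE ?ltr0n ?expn_gt0 // ler_nat.
rewrite natrX lnXn ?ltr0n // -[t%:R]/(1 *+ t) ler_wMn2r //.
(* [ln 2 <= 1] is the inequality [ln (1 + x) <= x] at [x = 1]. *)
by have := @le_ln1Dx R 1; apply; rewrite (lt_trans _ (@ltr01 R)) // oppr_lt0.
Qed.

(** The threshold [expR (expR 1)] makes [ln (ln k)] at least [1], so dividing by it only weakens the
    bound; [2^-1] inverts the factor lost to the incomplete block. *)
Lemma ratio_bound (R : realType) (k opt t n : nat) :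
  expR (expR 1) <= k%:R :> R -> (k <= 2 ^ t)%N -> (opt * t <= 2 * k * n)%N ->
  2^-1 * opt%:R * ln (k%:R : R) / (k%:R * ln (ln (k%:R : R))) <= n%:R.
Proof.
move=> ek kt le.
have k0 : 0 < k%:R :> R by apply: lt_le_trans ek; exact: expR_gt0.
have lnk : expR 1 <= ln (k%:R : R) by rewrite -[leLHS]expRK ler_ln ?posrE ?expR_gt0.
have lnk0 : 0 < ln (k%:R : R) by apply: lt_le_trans lnk; exact: expR_gt0.
have lnlnk : 1 <= ln (ln (k%:R : R)) by rewrite -[leLHS]expRK ler_ln ?posrE ?expR_gt0.
rewrite ler_pdivrMr; last by rewrite mulr_gt0 // (lt_le_trans ltr01).
have lt : ln (k%:R : R) <= t%:R by apply: ln_le_log2 => //; rewrite -(ltr0n R).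
have {}le : opt%:R * t%:R <= 2 * k%:R * n%:R :> R by rewrite -!natrM ler_nat.
have le1 : opt%:R * ln k%:R <= opt%:R * t%:R :> R by rewrite ler_wpM2l ?lt.
have le2 : k%:R * n%:R <= n%:R * (k%:R * ln (ln k%:R)) :> R.
  by rewrite mulrA [k%:R * _]mulrC ler_peMr // mulr_ge0 // ltW.
lra.
Qed.

(** * The complete program *)

Definition approx_hyperplane : cmd := setup ;; search ;; finish.

Lemma approx_hyperplaneP (R : realType) F d k (P : 'I_k -> 'rV[R]_d) :
  (0 < d)%N -> (4 * (d + k).+1 <= F)%N ->
  let t := block_size k in
  let s0 := init_state P in
  wp F approx_hyperplane (fun s' =>
    let a : 'rV[R]_d := \row_l xr s' l in
    a != 0 /\ exists n, (n <= #|on_hp a (xr s' d) P|)%N /\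
      ((0 < k)%N -> (OPT P * t <= 2 * k * n)%N))
    (Memory (nreg s0) (xreg s0)).
Proof.
move=> d0 dkF t s0.
have kF : (k <= F)%N by lia.
have dF : (d <= F)%N by lia.
have eF : (d + 1 <= F)%N by lia.
have TF : (2 ^ t <= F)%N by have := block_size_exp k; rewrite /t; lia.
have tF : (t <= F)%N by apply: leq_trans TF; rewrite ltnW // ltn_expl.
have t0 : (0 < t)%N by rewrite /t /block_size leq_maxl.
have A8 : (8 <= base_addr d k)%N by rewrite /base_addr; lia.
have Ad : (d < base_addr d k)%N by rewrite /base_addr; lia.
have inX (i : 'I_k) (l : 'I_d) : xreg s0 (i * d + l)%N = P i 0 l.
  (* [init_state] sums over all coordinates, so reading one back needs distinct addresses: division
     by [d] recovers the point and the coordinate. *)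
  have uniq_addr (i' : 'I_k) (l' : 'I_d) :
      (i * d + l == i' * d + l')%N = (i' == i) && (l' == l).
    apply/eqP/andP => [E|[/eqP -> /eqP ->] //].
    have qE (x : 'I_k) (y : 'I_d) : ((x * d + y) %/ d)%N = x.
      by rewrite divnMDl // divn_small // addn0.
    have rE (x : 'I_k) (y : 'I_d) : ((x * d + y) %% d)%N = y by rewrite modnMDl modn_small.
    split; apply/eqP/val_inj; first by rewrite /= -(qE i' l') -E qE.
    by rewrite /= -(rE i' l') -E rE.
  rewrite /= (bigD1 i) //= (bigD1 l) //= eqxx !big1 ?addr0 // => [i' ne|l' ne].
    by apply: big1 => l' _; rewrite uniq_addr (negPf ne).
  by rewrite uniq_addr (negPf ne) andbF.
have N0 r : (1 < r)%N -> nreg s0 r = 0%N by case: r => [|[|r]].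
apply: wp_seq.
apply: wp_mono (@setupP R F d k P (Memory (nreg s0) (xreg s0)) erefl erefl N0 inX d0 kF dF) _.
move=> s1 [es1 P1 S1] _; apply: wp_seq.
apply: wp_mono (searchP es1 A8 eF tF TF kF t0 P1 S1) _ => s2 [n S2 H2] fr2.
have es2 := env_frame es1 fr2 isT.
apply: wp_mono (finishP es2 Ad dF) _ => s3 X3 _ /=.
have aE : \row_l xr s3 l = stored_a d (xr s2) (nth 0%N (regs d k (base_addr d k) t) r_best).
  by apply/rowP => l; rewrite !mxE X3 // ltnW.
case: S2 => a0 nle; rewrite aE X3 //; split=> //; exists n; split=> // k0.
by apply: OPT_blocks H2; rewrite t0 block_size_le.
Qed.

Theorem theorem4 (R : realType) :
  exists (prog : seq instr) (c e : nat) (C : R) (k0 : nat),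
    0 < C /\
    forall (d k : nat) (P : 'I_k -> 'rV[R]_d),
      (0 < d)%N -> injective P ->
      exists s : state R,
        run prog (c * (d + k).+1 ^ e)%N (init_state P) = Some s /\
        out_a d s != 0 /\
        ((k0 <= k)%N ->
          C * (OPT P)%:R * ln (k%:R : R) / (k%:R * ln (ln (k%:R : R)))
            <= (#|on_hp (out_a d s) (out_b d s) P|)%:R).
Proof.
have [c [e cost_le]] := cost_poly approx_hyperplane.
(* With [F = 4 * (d + k).+1] the cost is at most [c * F.+1 ^ e], and [F.+1 <= 5 * (d + k).+1]. The
   threshold is the first integer above [expR (expR 1)]. *)
exists (compile 0 approx_hyperplane), (c * 5 ^ e)%N, e, 2^-1, (Num.truncn (expR (expR 1 : R))).+1.
split; first by rewrite invr_gt0.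
move=> d k P d0 _.
have [s' E [a0 [n [nle opt]]]] := approx_hyperplaneP P d0 (leqnn _).
exists (st_of (size (compile 0 approx_hyperplane)) s'); split.
  apply: run_compile E _; first by [].
  apply: leq_trans (cost_le _) _.
  rewrite -mulnA -expnMn leq_mul2l; apply/orP; right.
  by case: (e) => [|e'] //; rewrite leq_exp2r //; lia.
split; [exact: a0 | move=> kk].
have k0 : (0 < k)%N by apply: leq_trans kk.
apply: le_trans (_ : n%:R <= _); last by rewrite ler_nat; exact: nle.
apply: ratio_bound (block_size_ge k) (opt k0).
by apply: ltW; apply: lt_le_trans (truncnS_gt _) _; rewrite ler_nat.
Qed.
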